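(* Let $(M,\omega)$ be a closed symplectic manifold, $J_0$ a positive associated almost complex structure on $M$ and $g_0$ the associated metric corresponding to $J_0$. The relation $J=J_0e^P$ defines a one-to-one correspondence between the space $\mathrm{End}_{SJ_0}(TM)$ of smooth endomorphisms $P:TM\to TM$ that are symmetric with respect to $g_0$ and anticommute with $J_0$, and the space $\mathcal A_\omega$ of smooth positive associated almost complex structures on $M$.
   Context: An almost complex structure $J$ ($J^2=-I$) on $M$ is positive associated (with $\omega$) if $\omega(JX,JY)=\omega(X,Y)$ for all vector fields $X,Y$ and $\omega(X,JX)>0$ for $X\neq0$. The associated metric corresponding to $J_0$ is $g_0(X,Y)=\omega(X,J_0Y)$. $P$ anticommutes with $J_0$ means $PJ_0=-J_0P$; $e^P$ is the pointwise exponential. *)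

(* Defs.v *)
From HB Require Import structures.
From mathcomp Require Import all_boot all_order all_algebra.
From mathcomp Require Import all_classical all_reals all_analysis.
Set Implicit Arguments.
Unset Strict Implicit.
Unset Printing Implicit Defensive.
Import Order.TTheory GRing.Theory Num.Theory.
Import numFieldNormedType.Exports.
Local Open Scope classical_set_scope.
Local Open Scope ring_scope.

(* Only used for open [U], where the values of [f] outside [U] are irrelevant. *)
Fixpoint C_k {R : realType} {V W : normedModType R} (k : nat) (U : set V)
    (f : V -> W) : Prop :=
  if k is k'.+1 then
    (forall x, U x -> differentiable f x) /\ (forall v, C_k k' U ('D_v f))
  else forall x, U x -> {for x, continuous f}.

Definition smooth_on {R : realType} {V W : normedModType R} (U : set V)
  (f : V -> W) : Prop := forall k, C_k k U f.

(* Smooth n-manifolds without boundary.  [chart i] is only meaningful on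
   [dom i], and [param i], its inverse, only on [chart i @` dom i]. *)
Record manifold (R : realType) (n : nat) := Manifold {
  carrier :> topologicalType;
  manifold_hausdorff : hausdorff_space carrier;
  manifold_second_countable : @second_countable carrier;
  atlas : Type;
  dom : atlas -> set carrier;
  chart : atlas -> carrier -> 'rV[R]_n;
  param : atlas -> 'rV[R]_n -> carrier;
  dom_open : forall i, open (dom i);
  dom_cover : forall p, exists i, dom i p;
  codom_open : forall i, open (chart i @` dom i);
  chartK : forall i p, dom i p -> param i (chart i p) = p;
  chart_continuous : forall i, {within dom i, continuous (chart i)};
  param_continuous : forall i,
    {within chart i @` dom i, continuous (param i)};
  transition_smooth : forall i j,
    smooth_on (chart i @` (dom i `&` dom j)) (chart j \o param i) }.

Arguments dom {R n m} i.
Arguments chart {R n m} i p.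
Arguments param {R n m} i x.

Section Tangent.
Context {R : realType} {n : nat} (M : manifold R n).

(* A tangent vector at [p] is the family of its coordinate vectors in all the
   charts around [p], related by the differentials of the transition maps; the
   entries at charts that do not contain [p] are set to 0, so that equality of
   families is equality of tangent vectors. *)
Definition tangent_pred (p : M) : {pred (atlas M -> 'rV[R]_n)} := fun v =>
  `[< (forall i j, dom i p -> dom j p ->
         v j = 'd (chart j \o param i) (chart i p) (v i)) /\
      (forall i, ~ dom i p -> v i = 0) >].

Lemma tangent_pred_submod (p : M) : submod_closed (tangent_pred p).
Proof.
split=> [|a u v /asboolP[u1 u2] /asboolP[v1 v2]]; apply/asboolP.
  by split=> // i j pi pj; rewrite linear0.
split=> [i j pi pj|i npi]; rewrite !fctE.
  by rewrite (u1 i j pi pj) (v1 i j pi pj) linearP.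
by rewrite (u2 i npi) (v2 i npi) scaler0 addr0.
Qed.

HB.instance Definition _ (p : M) :=
  GRing.isSubmodClosed.Build R (atlas M -> 'rV[R]_n) (tangent_pred p)
    (tangent_pred_submod p).

Record tangent (p : M) := Tangent {
  coord :> atlas M -> 'rV[R]_n;
  coordP : coord \in tangent_pred p }.

HB.instance Definition _ (p : M) := [isSub for @coord p].
HB.instance Definition _ (p : M) := [Choice of tangent p by <:].
HB.instance Definition _ (p : M) := [SubChoice_isSubLmodule of tangent p by <:].

Lemma overlap_open (i j : atlas M) :
  open (chart i @` (dom i `&` dom j)).
Proof.
have -> : chart i @` (dom i `&` dom j) =
    (chart i @` dom i) `&` (param i @^-1` dom j).
  apply/seteqP; split=> [x [p [pi pj] <-]|x [[p pi <-]]] /=; rewrite ?chartK //.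
    by split=> //; exists p.
  by move=> pj; exists p.
have /continuousP /(_ _ (dom_open j)) := @param_continuous _ _ M i.
by move=> h; rewrite setIC; have := @open_setIS _ _
  (param i @^-1` dom j : set (subspace (chart i @` dom i))) (@codom_open _ _ M i) => ->.
Qed.

Lemma trans_cocycle (i j k : atlas M) (p : M) e :
  dom i p -> dom j p -> dom k p ->
  'd (chart k \o param i) (chart i p) e =
  'd (chart k \o param j) (chart j p) ('d (chart j \o param i) (chart i p) e).
Proof.
move=> pi pj pk.
have D a b : dom a p -> dom b p ->
    differentiable (chart b \o param a : 'rV[R]_n -> 'rV[R]_n) (chart a p).
  move=> pa pb; have [h _] := @transition_smooth _ _ M a b 1%N; apply: h; by exists p.
pose f : 'rV[R]_n -> 'rV[R]_n := chart j \o param i.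
pose g : 'rV[R]_n -> 'rV[R]_n := chart k \o param j.
have E : f (chart i p) = chart j p by rewrite /f /= chartK.
have Df : differentiable f (chart i p) by exact: D.
have Dg : differentiable g (f (chart i p)) by rewrite E; exact: D.
have H1 : 'd (g \o f) (chart i p) e = 'd g (f (chart i p)) ('d f (chart i p) e).
  exact: (congr1 (fun h => h e) (diff_comp Df Dg)).
have H2 : 'd g (f (chart i p)) = 'd g (chart j p) :> (_ -> _) by case: _ / E.
have H3 := congr1 (fun h => h ('d f (chart i p) e)) H2.
apply: etrans (etrans H1 H3).
apply: etrans (esym (deriveE _ (D _ _ pi pk))) _.
apply: etrans (deriveE _ (differentiable_comp Df Dg)).
apply: near_eq_derive.
have : nbhs (chart i p) (chart i @` (dom i `&` dom j)).
  apply: open_nbhs_nbhs; split; first exact: overlap_open.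
  exact: (imageP (chart i) (conj pi pj)).
move=> N; apply: (filterS _ N).
move=> x [q [qi qj] <-]; rewrite /g /f.
change (chart k (param i (chart i q)) =
  chart k (param j (chart j (param i (chart i q))))).
rewrite (chartK qi).
rewrite (chartK qj).
reflexivity.
Qed.

Lemma trans_id (i : atlas M) (p : M) e :
  dom i p -> 'd (chart i \o param i) (chart i p) e = e.
Proof.
move=> pi.
have D : differentiable (chart i \o param i : 'rV[R]_n -> 'rV[R]_n) (chart i p).
  have [h _] := @transition_smooth _ _ M i i 1%N; apply: h; by exists p.
rewrite -deriveE // (@near_eq_derive _ _ _ _ id) ?derive_id //.
have : nbhs (chart i p) (chart i @` dom i).
  by apply: open_nbhs_nbhs; split; [exact: codom_open|exists p].
by apply: filterS => x [q qi <-] /=; rewrite chartK.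
Qed.

(* The coordinates in any chart around [p] identify [tangent p] with R^n. *)
Lemma tangent_coord_bij (i : atlas M) (p : M) : dom i p ->
  set_bij [set: tangent p] [set: 'rV[R]_n] (fun v : tangent p => v i).
Proof.
move=> pi; split=> // [u v _ _ uv|e _].
  apply: val_inj; apply/funext => j /=.
  have /asboolP[u1 u2] := coordP u; have /asboolP[v1 v2] := coordP v.
  have [pj|npj] := pselect (dom j p); last by rewrite u2 ?v2.
  by rewrite (u1 i j) // (v1 i j) // uv.
pose w j := if `[< dom j p >] then 'd (chart j \o param i) (chart i p) e else 0.
have wP : w \in tangent_pred p.
  apply/asboolP; split=> [j k pj pk|j npj]; last by rewrite /w asboolF.
  by rewrite /w !asboolT //; exact: trans_cocycle.
exists (Tangent wP) => //=; rewrite /w asboolT //; exact: trans_id.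
Qed.

(* The topology of the finite-dimensional space [tangent p], read in charts. *)
Definition tangent_cvg (p : M) (u : nat -> tangent p) (w : tangent p) : Prop :=
  forall i, dom i p -> u k i @[k --> \oo] --> w i.

Definition tangent_exp (p : M) (A : tangent p -> tangent p) (v : tangent p) :
  tangent p :=
  xget 0 [set w | tangent_cvg (series (fun k => (k`!%:R)^-1 *: iter k A v)) w].

Definition endo_field := forall p : M, tangent p -> tangent p.

(* [A] is the matrix of [P] in the frame of the chart [i], acting on row
   vectors of coordinates. *)
Definition smooth_endo (P : endo_field) : Prop :=
  (forall p, linear (P p)) /\
  forall i, exists A : 'rV[R]_n -> 'M[R]_n,
    smooth_on (chart i @` dom i) A /\
    forall p (v : tangent p), dom i p -> P p v i = v i *m A (chart i p).

Definition bilin_field := forall p : M, tangent p -> tangent p -> R.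

Definition gram_in_chart (om : bilin_field) i (W : 'rV[R]_n -> 'M[R]_n) : Prop :=
  forall p (u v : tangent p), dom i p ->
    om p u v = (u i *m W (chart i p) *m (v i)^T) 0 0.

Definition smooth_2form (om : bilin_field) : Prop :=
  [/\ forall p u, scalar (om p u), forall p v, scalar (om p ^~ v),
      forall p u, om p u u = 0 &
      forall i, exists2 W, gram_in_chart om i W &
        smooth_on (chart i @` dom i) W].

Definition partial (a : 'I_n) (W : 'rV[R]_n -> 'M[R]_n) : 'rV[R]_n -> 'M[R]_n :=
  'D_(delta_mx 0 a) W.

(* The components (d om)_{abc} of the exterior derivative vanish. *)
Definition closed_2form (om : bilin_field) : Prop :=
  forall i W, gram_in_chart om i W ->
  forall x, (chart i @` dom i) x -> forall a b c,
    partial a W x b c - partial b W x a c + partial c W x a b = 0.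

Definition symplectic (om : bilin_field) : Prop :=
  [/\ smooth_2form om, closed_2form om &
      forall p (u : tangent p), (forall v, om p u v = 0) -> u = 0].

Definition almost_complex (J : endo_field) : Prop :=
  smooth_endo J /\ forall p v, J p (J p v) = - v.

Definition positive_associated (om : bilin_field) (J : endo_field) : Prop :=
  [/\ almost_complex J,
      forall p u v, om p (J p u) (J p v) = om p u v &
      forall p u, u != 0 -> 0 < om p u (J p u)].

Definition associated_metric (om : bilin_field) (J : endo_field) : bilin_field :=
  fun p u v => om p u (J p v).

Definition End_SJ (om : bilin_field) (J0 : endo_field) : set endo_field :=
  [set P | [/\ smooth_endo P,
     forall p u v, associated_metric om J0 (P p u) v =
                   associated_metric om J0 u (P p v) &
     forall p v, P p (J0 p v) = - J0 p (P p v)]].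

Definition A_om (om : bilin_field) : set endo_field :=
  [set J | positive_associated om J].

End Tangent.

(* Main.v *)
Require Import Defs.
From HB Require Import structures.
From mathcomp Require Import all_boot all_order all_algebra.
From mathcomp Require Import all_classical all_reals all_analysis.
From mathcomp Require Import complex ring lra.

(** Why the theorem holds.  Fix a point; then it is linear algebra on a symplectic
    vector space with metric [g0 = omega(., J0 .)].

    If [P] is [g0]-symmetric and anticommutes with [J0], then [J0 e^P = e^(-P) J0],
    so [J0 e^P] squares to [-1]; moreover [omega(P u, v) = - omega(u, P v)], so
    [e^P] preserves [omega], and [omega(u, J0 e^P u) = g0(e^(P/2) u, e^(P/2) u)]
    is positive ([associated_mexp]).

    Conversely, for [J] positive associated, [A = J0^-1 J] is [g0]-symmetric with
    positive eigenvalues ([associated_quotient]), so it is the exponential of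
    some diagonalizable [P].  A diagonalizable endomorphism is determined by its
    exponential ([mexp_inj]).  This gives injectivity of the correspondence, and also
    that the logarithm [P] of [A] has the required symmetries: the adjoint of [P] and
    [- J0 P J0^-1] are diagonalizable and have the exponential [A] as well
    ([associated_log]).  Symmetric endomorphisms are diagonalizable by the
    spectral theorem ([spectral]).

    What remains is that [e^P] and [log A] depend smoothly on [P] and [A], even
    though eigenvectors and eigenvalues need not.  Both are locally
    power series: the exponential series, and the series of the logarithm
    after scaling and a constant change of basis ([C_k_mlog]).  A power series
    of a smooth matrix function is smooth ([C_k_mxpser]): evaluating it at the block
    matrix with rows [B H] and [0 B] puts its derivative at [B] along [H] in
    the upper right corner, so the derivative of such a function is a corner of a
    function of the same kind, and induction on the order of differentiability
    applies. *)

Set Implicit Arguments.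
Unset Strict Implicit.
Unset Printing Implicit Defensive.
Import Order.TTheory GRing.Theory Num.Theory.
Import numFieldNormedType.Exports.
Local Open Scope classical_set_scope.
Local Open Scope ring_scope.

(** * Series of matrices *)

Section MatrixAnalysis.
Context {R : realType}.

Lemma mx_norm_leP m n (A : 'M[R]_(m, n)) (e : R) : 0 <= e ->
  (`|A| <= e) <-> (forall i j, `|A i j| <= e).
Proof.
move=> e0; rewrite [`|A|]/Num.Def.normr/= mx_normrE; split=> [h i j|h].
  apply: le_trans h; exact: (le_bigmax _ (fun ij => `|A ij.1 ij.2|) (i, j)).
by apply: bigmax_le => // -[i j] _; exact: h.
Qed.

Lemma ler_entry_norm m n (A : 'M[R]_(m, n)) i j : `|A i j| <= `|A|.
Proof. exact: (mx_norm_leP A (normr_ge0 A)).1. Qed.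

(** Packs a proof of linearity, so that a map can be used through the theory of
    linear maps without declaring an instance for it. *)
Definition linear_of (V W : lmodType R) (f : V -> W) (lf : linear f) :
  {linear V -> W} := HB.pack f (GRing.isLinear.Build R V W _ f lf).

Lemma mx_linear_continuous m n (V : normedModType R) (f : 'M[R]_(m, n) -> V) :
  linear f -> continuous f.
Proof.
move=> lf; pose L := linear_of lf.
apply: (bounded_linear_continuous (f := L)); apply/bounded_funP => r.
exists (\sum_i \sum_j r * `|L (delta_mx i j)|) => A Ar.
rewrite {1}(matrix_sum_delta A) linear_sum (le_trans (ler_norm_sum _ _ _))//.
apply: ler_sum => i _; rewrite linear_sum (le_trans (ler_norm_sum _ _ _))//.
apply: ler_sum => j _; rewrite linearZ normrZ ler_wpM2r//.
exact: le_trans (ler_entry_norm _ _ _) Ar.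
Qed.

Lemma cvg_mx m n (X : nat -> 'M[R]_(m, n)) (l : 'M[R]_(m, n)) :
  (forall i j, X k i j @[k --> \oo] --> l i j) -> X k @[k --> \oo] --> l.
Proof.
move=> h; apply/cvgrPdist_le => e e0; near=> k.
apply/mx_norm_leP; first exact: ltW.
suff: forall ij : 'I_m * 'I_n, `|(l - X k) ij.1 ij.2| <= e.
  by move=> H i j; exact: (H (i, j)).
near: k; apply: filter_forall => -[i j] /=.
have /cvgrPdist_le/(_ e e0) := h i j.
by apply: filterS => k; rewrite !mxE.
Unshelve. all: by end_near. Qed.

Lemma series_mxE m n (X : nat -> 'M[R]_(m, n)) k i j :
  series X k i j = series (fun k => X k i j) k.
Proof. by rewrite /series /= summxE. Qed.

Lemma cvg_series_mx m n (X : nat -> 'M[R]_(m, n)) (u : nat -> R) :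
  cvgn (series u) -> (forall k i j, `|X k i j| <= u k) -> cvgn (series X).
Proof.
move=> cu Xu.
suff : series X k @[k --> \oo] --> \matrix_(i, j) limn (series (fun k => X k i j)).
  by move/cvgP.
apply: cvg_mx => i j; rewrite mxE.
under eq_cvg do rewrite series_mxE.
apply: (@normed_cvg R R).
apply: (series_le_cvg _ _ _ cu) => k; [exact: normr_ge0| |exact: Xu].
exact: le_trans (normr_ge0 _) (Xu k i j).
Qed.

Lemma lim_series_mx m n (X : nat -> 'M[R]_(m, n)) (l : 'M[R]_(m, n)) :
  series X @ \oo --> l -> limn (series X) = l.
Proof. exact: cvg_lim. Qed.

Lemma linear_series m n p q (f : 'M[R]_(m, n) -> 'M[R]_(p, q))
    (X : nat -> 'M[R]_(m, n)) (l : 'M[R]_(m, n)) : linear f ->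
  series X @ \oo --> l -> series (fun k => f (X k)) @ \oo --> f l.
Proof.
move=> lf cX; have -> : series (fun k => f (X k)) = f \o series X.
  by apply/funext => k; rewrite /series /= -[RHS]/(linear_of lf _) linear_sum.
have fc : {for l, continuous f} by exact: mx_linear_continuous.
exact: (cvg_comp (series X) f cX fc).
Qed.

Lemma norm_lim_series_mx m n (X : nat -> 'M[R]_(m, n)) (u : nat -> R) :
  cvgn (series u) -> (forall k, 0 <= u k) -> (forall k i j, `|X k i j| <= u k) ->
  `|limn (series X)| <= limn (series u).
Proof.
move=> cu u0 Xu; have cX := cvg_series_mx cu Xu.
have U k : series u k <= limn (series u).
  by apply: nondecreasing_cvgn_le => //; exact: nondecreasing_series.
apply/mx_norm_leP => [|i j]; first by apply: le_trans (U 0); rewrite /series /= big_nil.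
have h : series X k i j @[k --> \oo] --> limn (series X) i j.
  exact: (cvg_comp (series X) (fun M : 'M[R]_(m, n) => M i j) cX (@coord_continuous R m n i j _)).
apply: (cvgr_to_le (cvg_norm h)).
near=> k; apply: le_trans (U k).
rewrite series_mxE /series /= (le_trans (ler_norm_sum _ _ _))//.
by apply: ler_sum => l _; exact: Xu.
Unshelve. all: by end_near. Qed.

(** * Row-sum bounds *)

(** [rowbd r A] says that [A] has operator norm at most [r] for the supremum
    norm on columns.  This norm is submultiplicative, as the norm by the largest
    entry is not, and gives a diagonal matrix its largest entry; as a predicate
    it composes without computing maxima. *)
Definition rowbd m n (r : R) (A : 'M[R]_(m, n)) :=
  forall i, \sum_j `|A i j| <= r.

Lemma rowbd_entry m n (r : R) (A : 'M[R]_(m, n)) i j : rowbd r A -> `|A i j| <= r.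
Proof.
move=> /(_ i); apply: le_trans; rewrite (bigD1 j)//= lerDl.
by apply: sumr_ge0.
Qed.

Lemma rowbdD m n (r s : R) (A B : 'M[R]_(m, n)) :
  rowbd r A -> rowbd s B -> rowbd (r + s) (A + B).
Proof.
move=> rA sB i; apply: le_trans (lerD (rA i) (sB i)).
rewrite -big_split /=; apply: ler_sum => j _; rewrite mxE; exact: ler_normD.
Qed.

Lemma rowbdZ m n (r c : R) (A : 'M[R]_(m, n)) : rowbd r A -> rowbd (`|c| * r) (c *: A).
Proof.
move=> rA i; under eq_bigr do rewrite mxE normrM.
by rewrite -mulr_sumr ler_wpM2l.
Qed.

Lemma rowbdM m n p (r s : R) (A : 'M[R]_(m, n)) (B : 'M[R]_(n, p)) : 0 <= s ->
  rowbd r A -> rowbd s B -> rowbd (r * s) (A *m B).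
Proof.
move=> s0 rA sB i.
apply: (@le_trans _ _ (\sum_k \sum_j `|A i k| * `|B k j|)).
  rewrite exchange_big /=; apply: ler_sum => j _; rewrite mxE.
  apply: le_trans (ler_norm_sum _ _ _) _.
  by apply: ler_sum => k _; rewrite normrM.
under eq_bigr do rewrite -mulr_sumr.
apply: (@le_trans _ _ (\sum_k `|A i k| * s)).
  by apply: ler_sum => k _; rewrite ler_wpM2l.
by rewrite -mulr_suml ler_wpM2r.
Qed.

Lemma rowbd_le m n (r s : R) (A : 'M[R]_(m, n)) : r <= s -> rowbd r A -> rowbd s A.
Proof. by move=> rs rA i; apply: le_trans (rA i) rs. Qed.

Lemma rowbd_norm m n (A : 'M[R]_(m, n)) : rowbd (n%:R * `|A|) A.
Proof.
move=> i; apply: (@le_trans _ _ (\sum_(j < n) `|A|)).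
  by apply: ler_sum => j _; exact: ler_entry_norm.
by rewrite sumr_const card_ord mulr_natl.
Qed.

Lemma rowbd1 m : rowbd 1 (1%:M : 'M[R]_m).
Proof.
move=> i; rewrite (bigD1 i)//= mxE eqxx normr1 big1 ?addr0// => j ji.
by rewrite mxE eq_sym (negPf ji) normr0.
Qed.

Lemma rowbdX m (r : R) (A : 'M[R]_m) k : 0 <= r -> rowbd r A -> rowbd (r ^+ k) (A ^+ k).
Proof.
move=> r0 rA; elim: k => [|k ih]; first by rewrite !expr0; exact: rowbd1.
by rewrite !exprS; apply: rowbdM => //; exact: exprn_ge0.
Qed.

Lemma rowbd_block m n p q (r s : R) (A : 'M[R]_(m, n)) (B : 'M[R]_(m, p)) (D : 'M[R]_(q, p)) :
  0 <= s -> rowbd r A -> rowbd s B -> rowbd r D ->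
  rowbd (r + s) (block_mx A B 0 D : 'M[R]_(m + q, n + p)).
Proof.
move=> s0 rA sB rD i; rewrite big_split_ord /= -(fintype.splitK i).
case: (fintype.split i) => k /=.
  under eq_bigr do rewrite block_mxEul.
  by under [X in _ + X]eq_bigr do rewrite block_mxEur; exact: lerD.
under eq_bigr do rewrite block_mxEdl mxE normr0.
under [X in _ + X]eq_bigr do rewrite block_mxEdr.
by rewrite big1// add0r; apply: le_trans (rD k) _; rewrite lerDl.
Qed.

Lemma near_rowbd m n (r s : R) (A : 'M[R]_(m, n)) : r < s -> rowbd r A ->
  \forall B \near A, rowbd s B.
Proof.
move=> rs rA.
have e0 : 0 < (s - r) / n.+1%:R by rewrite divr_gt0 ?subr_gt0.
have /cvgrPdist_le/(_ _ e0) := @cvg_id _ (nbhs A).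
apply: filterS => B; rewrite distrC => AB.
rewrite -(subrK A B) addrC; apply: rowbd_le (rowbdD rA (rowbd_norm (B - A))).
rewrite -lerBrDl; apply: le_trans (_ : n.+1%:R * `|B - A| <= _).
  by rewrite ler_wpM2r// ler_nat.
by rewrite mulrC -ler_pdivlMr.
Qed.


(** * Power series of a matrix and their derivative *)

Definition summable_at (a : nat -> R) (rho : R) :=
  cvgn (series (fun k => `|a k| * rho ^+ k)).

Definition mxpser m (a : nat -> R) (B : 'M[R]_m) : 'M[R]_m :=
  limn (series (fun k => a k *: B ^+ k)).

(** The matrix [B + eps H] over the dual numbers, in block form: a power series
    evaluated at [dblock B H] has its value at [B] on the diagonal and its
    derivative at [B] along [H] in the upper right corner.  So derivatives of
    power series are again power series, of matrices of twice the size. *)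
Definition dblock m (B H : 'M[R]_m) : 'M[R]_(m + m) := block_mx B H 0 B.

(** The derivative of the [k]-th power at [B] along [H]. *)
Definition dpow m (B H : 'M[R]_m) k := ursubmx (dblock B H ^+ k).

Lemma dblockX m (B H : 'M[R]_m) k :
  dblock B H ^+ k = dblock (B ^+ k) (dpow B H k).
Proof.
suff [D E] : exists D, dblock B H ^+ k = dblock (B ^+ k) D.
  by rewrite /dpow E /dblock block_mxKur.
elim: k => [|k [D ih]]; first by exists 0; rewrite !expr0; exact: scalar_mx_block.
exists (B *m D + H *m B ^+ k).
rewrite !exprS ih; rewrite -mulmxE /dblock mulmx_block.
by rewrite !mul0mx !mulmx0 !addr0 !add0r.
Qed.

Lemma dpow0 m (B H : 'M[R]_m) : dpow B H 0 = 0.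
Proof. by rewrite /dpow expr0 -[1]/(1%:M) scalar_mx_block block_mxKur. Qed.

Lemma dpowS m (B H : 'M[R]_m) k : dpow B H k.+1 = B *m dpow B H k + H *m B ^+ k.
Proof.
rewrite {1}/dpow exprS dblockX -mulmxE /dblock mulmx_block block_mxKur.
by [].
Qed.

Lemma dpow_linear m (B : 'M[R]_m) k : linear (fun H => dpow B H k).
Proof.
elim: k => [|k ih] c H K; first by rewrite !dpow0 scaler0 addr0.
rewrite !dpowS ih mulmxDr mulmxDl scalerDr -scalemxAr -scalemxAl.
by rewrite addrACA.
Qed.

Lemma ursubmx_linear m n p q :
  linear (ursubmx : 'M[R]_(m + n, p + q) -> 'M[R]_(m, q)).
Proof. by move=> c A B; apply/matrixP => i j; rewrite !mxE. Qed.

Section Differentiation.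
Variables (m : nat) (a : nat -> R) (rho r : R) (B : 'M[R]_m).
Hypotheses (sa : summable_at a rho) (r0 : 0 <= r) (rrho : r < rho) (rB : rowbd r B).

Definition mxpser_diff (H : 'M[R]_m) : 'M[R]_m :=
  limn (series (fun k => a k *: dpow B H k)).

(** Everything below is a comparison with the scalar series at [rho]; the constant
    [c] is what makes the estimates of the derivative and of the remainder
    small in [H]. *)
Lemma dominated_mxpser (X : nat -> 'M[R]_m) (c : R) :
  0 <= c -> (forall k, rowbd (c * rho ^+ k) (X k)) ->
  series (fun k => a k *: X k) @ \oo --> limn (series (fun k => a k *: X k)) /\
  `|limn (series (fun k => a k *: X k))| <= c * limn (series (fun k => `|a k| * rho ^+ k)).
Proof.
move=> c0 cX; set u := fun k => `|a k| * rho ^+ k.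
have rho0 : 0 <= rho by exact: le_trans r0 (ltW rrho).
have ca k i j : `|(a k *: X k) i j| <= (c *: u) k.
  have -> : (c *: u) k = `|a k| * (c * rho ^+ k) by rewrite mulrCA.
  by rewrite mxE normrM ler_wpM2l//; exact: rowbd_entry (cX k).
have su : cvgn (series (c *: u)) by exact: is_cvg_seriesZ.
split; first exact: (cvg_series_mx su ca).
rewrite -[leRHS](lim_seriesZ c sa); apply: norm_lim_series_mx su _ ca => k.
by rewrite mulr_ge0// mulr_ge0// exprn_ge0.
Qed.

(** The exact bound is [k h r^(k-1)].  Giving up [d] in the radius absorbs the
    factor [k] and leaves a geometric bound, proportional to [h]. *)
Lemma rowbd_dpow (h d : R) (H : 'M[R]_m) k : 0 <= h -> 0 < d -> r + d <= rho ->
  rowbd h H -> rowbd (h / d * rho ^+ k) (dpow B H k).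
Proof.
move=> h0 d0 rd hH; have hd : 0 <= h / d by rewrite divr_ge0// ltW.
have rho0 := le_trans r0 (ltW rrho).
elim: k => [|k ih].
  rewrite dpow0 => i; under eq_bigr do rewrite mxE normr0.
  by rewrite big1// expr0 mulr1.
rewrite dpowS; apply: rowbd_le (rowbdD (rowbdM _ rB ih) (rowbdM _ hH (rowbdX k r0 rB))).
- apply: (@le_trans _ _ (r * (h / d * rho ^+ k) + h * rho ^+ k)).
    by rewrite lerD2l ler_wpM2l// lerXn2r// ?nnegrE// ltW.
  have -> : r * (h / d * rho ^+ k) + h * rho ^+ k = h / d * rho ^+ k * (r + d).
    field; lra.
  by rewrite exprSr mulrA ler_wpM2l// mulr_ge0// exprn_ge0.
- by rewrite mulr_ge0// exprn_ge0.
- exact: exprn_ge0.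
Qed.

(** The second order remainder obeys the recurrence
    [Rem (k+1) = (B + H) Rem k + H D k], where [D k] is the derivative of the [k]-th
    power.  The same loss of radius as for [D k] gives a geometric bound,
    quadratic in [h]. *)
Lemma rowbd_exp_remainder (h d : R) (H : 'M[R]_m) k : 0 <= h -> 0 < d -> r + d + h <= rho ->
  rowbd h H ->
  rowbd ((h / d) ^+ 2 * rho ^+ k) ((B + H) ^+ k - B ^+ k - dpow B H k).
Proof.
move=> h0 d0 rd hH; have hd : 0 <= h / d by rewrite divr_ge0// ltW.
have rho0 := le_trans r0 (ltW rrho).
elim: k => [|k ih].
  rewrite dpow0 !expr0 subrr subr0 => i; under eq_bigr do rewrite mxE normr0.
  by rewrite big1// mulr1 exprn_ge0.
have -> : (B + H) ^+ k.+1 - B ^+ k.+1 - dpow B H k.+1 =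
    (B + H) *m ((B + H) ^+ k - B ^+ k - dpow B H k) + H *m dpow B H k.
  rewrite dpowS !exprS -!mulmxE !mulmxBr !mulmxDl !opprD.
  by rewrite -[RHS]addrA subrK !addrA [LHS]addrAC.
apply: rowbd_le (rowbdD (rowbdM _ (rowbdD rB hH) ih) (rowbdM _ hH (rowbd_dpow k h0 d0 _ hH))).
- have -> : (r + h) * ((h / d) ^+ 2 * rho ^+ k) + h * (h / d * rho ^+ k) =
    (h / d) ^+ 2 * rho ^+ k * (r + d + h) by field; lra.
  by rewrite [rho ^+ k.+1]exprSr mulrA ler_wpM2l// mulr_ge0// exprn_ge0.
- by rewrite mulr_ge0// exprn_ge0.
- by rewrite mulr_ge0// exprn_ge0.
- lra.
Qed.

Lemma mxpser_cvg :
  series (fun k => a k *: B ^+ k) @ \oo --> mxpser a B.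
Proof.
have [] := @dominated_mxpser (fun k => B ^+ k) 1 ler01 _ => // k.
rewrite mul1r; apply: rowbd_le (rowbdX k r0 rB).
by rewrite lerXn2r// ?nnegrE ?(le_trans r0)// ltW.
Qed.

Lemma mxpser_diff_cvg H :
  series (fun k => a k *: dpow B H k) @ \oo --> mxpser_diff H.
Proof.
have rd0 : 0 < rho - r by rewrite subr_gt0.
have nH : 0 <= m%:R * `|H| by rewrite mulr_ge0.
have [] := @dominated_mxpser (fun k => dpow B H k) (m%:R * `|H| / (rho - r)) _ _ => //.
  by rewrite divr_ge0// ltW.
move=> k; apply: rowbd_dpow => //; last exact: rowbd_norm.
by rewrite addrC subrK.
Qed.

Lemma mxpser_diff_linear : linear mxpser_diff.
Proof.
move=> c H K; apply: lim_series_mx.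
have -> : series (fun k => a k *: dpow B (c *: H + K) k) =
    c *: series (fun k => a k *: dpow B H k) + series (fun k => a k *: dpow B K k).
  apply/funext => k; rewrite /series /= !fctE scaler_sumr -big_split /=.
  by apply: eq_bigr => i _; rewrite dpow_linear scalerDr !scalerA [c * _]mulrC.
by apply: cvgD; [apply: cvgZr; exact: mxpser_diff_cvg|exact: mxpser_diff_cvg].
Qed.

End Differentiation.

(** Summing the remainders of all powers gives a remainder for the series that is
    quadratic in the increment. *)
Lemma mxpser_differentiable m (a : nat -> R) (rho r : R) (B : 'M[R]_m) :
  summable_at a rho -> 0 <= r -> r < rho -> rowbd r B ->
  differentiable (mxpser (m := m) a) B /\
  'd (mxpser (m := m) a) B = mxpser_diff a B :> (_ -> _).
Proof.
move=> sa r0 rrho rB.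
pose L := linear_of (mxpser_diff_linear sa r0 rrho rB).
have Lc : continuous L by apply: mx_linear_continuous; exact: (mxpser_diff_linear sa r0 rrho rB).
set S := limn (series (fun k => `|a k| * rho ^+ k)).
have S0 : 0 <= S.
  have u0 k : 0 <= `|a k| * rho ^+ k.
    by rewrite mulr_ge0// exprn_ge0// (le_trans r0)// ltW.
  apply: le_trans (normr_ge0 _) (@norm_lim_series_mx m m (fun=> 0) _ sa u0 _).
  by move=> k i j; rewrite mxE normr0.
(* half of the gap pays for the loss of radius, the other half for [H] *)
pose d := (rho - r) / 2; have d0 : 0 < d by rewrite divr_gt0// subr_gt0.
have rem H : m%:R * `|H| <= d ->
    `|mxpser a (B + H) - mxpser a B - mxpser_diff a B H| <= (m%:R * `|H| / d) ^+ 2 * S.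
  move=> Hd; have h0 : 0 <= m%:R * `|H| by rewrite mulr_ge0.
  pose h := m%:R * `|H|.
  have rdh : r + d + h <= rho.
    by rewrite -addrA -lerBrDl; apply: le_trans (lerD (lexx d) Hd) _; rewrite -splitr.
  have bH : rowbd h H by exact: rowbd_norm.
  have hd0 : 0 <= (h / d) ^+ 2 by rewrite exprn_ge0// divr_ge0// ltW.
  have [_] := dominated_mxpser sa r0 rrho hd0
    (fun k => rowbd_exp_remainder r0 rrho rB k h0 d0 rdh bH).
  suff -> : limn (series (fun k => a k *: ((B + H) ^+ k - B ^+ k - dpow B H k)))
    = mxpser a (B + H) - mxpser a B - mxpser_diff a B H by [].
  apply: lim_series_mx.
  have -> : series (fun k => a k *: ((B + H) ^+ k - B ^+ k - dpow B H k)) =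
    series (fun k => a k *: (B + H) ^+ k) - series (fun k => a k *: B ^+ k) -
    series (fun k => a k *: dpow B H k).
    apply/funext => k; rewrite /series /= !fctE -!sumrB.
    by apply: eq_bigr => i _; rewrite !scalerBr.
  have rh0 : 0 <= r + h by rewrite addr_ge0.
  have rhr : r + h < rho by lra.
  apply: cvgB; last exact: (mxpser_diff_cvg sa r0 rrho rB).
  apply: cvgB; last exact: mxpser_cvg sa r0 rrho rB.
  exact: mxpser_cvg sa rh0 rhr (rowbdD rB bH).
have dB : mxpser a \o shift B = cst (mxpser a B) + L +o_ (0 : 'M[R]_m) id.
  suff key (e : R) : 0 < e -> \forall H \near (0 : 'M[R]_m),
      `|mxpser a (B + H) - mxpser a B - mxpser_diff a B H| <= e * `|H|.
    apply/eqaddoP => e /key; apply: filterS => H.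
    by rewrite /= !fctE /= (addrC H) opprD addrA.
  move=> e0; pose C := (m%:R / d) ^+ 2 * S.
  have C0 : 0 <= C by rewrite mulr_ge0// exprn_ge0// divr_ge0// ltW.
  have e1 : 0 < Num.min (e / (C + 1)) (d / (m%:R + 1)).
    by rewrite lt_min; apply/andP; split; rewrite divr_gt0// ltr_wpDl.
  have /cvgrPdist_le/(_ _ e1) := @cvg_id _ (nbhs (0 : 'M[R]_m)).
  apply: filterS => H; rewrite sub0r normrN le_min => /andP[He Hd].
  apply: le_trans (rem H _) _.
    rewrite ler_pdivlMr ?ltr_wpDl// in Hd; apply: le_trans Hd.
    by rewrite mulrC ler_wpM2l// lerDl.
  rewrite (_ : _ * S = C * `|H| * `|H|); last first.
    by rewrite /C !exprMn [RHS]mulrAC; ring.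
  rewrite ler_wpM2r//; rewrite ler_pdivlMr ?ltr_wpDl// in He; apply: le_trans He.
  by rewrite mulrC ler_wpM2l// lerDl.
have E : 'd (mxpser a) B = mxpser_diff a B :> (_ -> _) by exact: (diff_unique Lc dB).
by split=> //; apply/diff_locallyP; rewrite E.
Qed.

End MatrixAnalysis.

(** * Calculus of [C_k] maps *)

Section Smoothness.
Context {R : realType} {V : normedModType R}.

Lemma near_eq_differentiable (W : normedModType R) (f g : V -> W) (x : V) :
  (\near x, f x = g x) -> differentiable f x -> differentiable g x.
Proof.
move=> fg df; have [dfc /eqaddoP fE] := (diff_locallyP _ _).1 df.
have fgx : f x = g x := nbhs_singleton fg.
have gE : g \o shift x = cst (g x) + 'd f x +o_ (0 : V) id.
  apply/eqaddoP => e /fE; move: fg; rewrite (near_shift 0 x) subr0 => fg.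
  apply: filterS2 fg => y /= fgy; rewrite !fctE /= -fgx.
  by rewrite -[g (y + x)]fgy.
by apply/diff_locallyP; rewrite (diff_unique dfc gE).
Qed.

Lemma C_k_ext (W : normedModType R) k (U : set V) (f g : V -> W) : open U ->
  {in U, f =1 g} -> C_k k U f -> C_k k U g.
Proof.
move=> oU; have near_U (f' g' : V -> W) x : {in U, f' =1 g'} -> U x -> \near x, f' x = g' x.
  move=> fg Ux; have := open_nbhs_nbhs (conj oU Ux).
  by apply: filterS => y Uy; apply: fg; rewrite inE.
elim: k f g => [|k ih] f g fg /=.
  move=> cf x Ux; rewrite /prop_for /continuous_at -(fg x) ?inE//.
  apply: cvg_trans (cf x Ux); apply: near_eq_cvg; exact: near_U Ux.
move=> [df Df]; split=> [x Ux|v].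
  by apply: near_eq_differentiable (df x Ux); exact: near_U Ux.
apply: ih (Df v) => x; rewrite inE => Ux; apply: near_eq_derive; exact: near_U Ux.
Qed.

(** The definition of [C_k] only looks at [f] near each point of the set. *)
Lemma C_k_local (W : normedModType R) k (U : set V) (f : V -> W) :
  (forall x, U x -> exists2 N : set V, N x & C_k k N f) -> C_k k U f.
Proof.
elim: k f => [|k ih] f /= Uf.
  by move=> x Ux; have [N Nx] := Uf x Ux; exact.
split=> [x Ux|v]; first by have [N Nx [+ _]] := Uf x Ux; exact.
by apply: ih => x Ux; have [N Nx [_ /(_ v)]] := Uf x Ux; exists N.
Qed.

Lemma C_k_subset (W : normedModType R) k (U N : set V) (f : V -> W) :
  N `<=` U -> C_k k U f -> C_k k N f.
Proof. by move=> NU Uf; apply: C_k_local => x Nx; exists U => //; exact: NU. Qed.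

Lemma C_k_continuous (W : normedModType R) k (U : set V) (f : V -> W) x :
  C_k k U f -> U x -> {for x, continuous f}.
Proof.
by case: k => [|k] /= => [cf /cf //|[df _] /df]; exact: differentiable_continuous.
Qed.

Lemma C_kW (W : normedModType R) k (U : set V) (f : V -> W) :
  C_k k.+1 U f -> C_k k U f.
Proof.
elim: k f => [|k ih] f Uf; first by move=> x Ux; exact: C_k_continuous Uf Ux.
by case: Uf => df Df; split=> // v; exact: ih (Df v).
Qed.

Lemma C_k_cst (W : normedModType R) k (U : set V) (c : W) : C_k k U (cst c).
Proof.
elim: k c => [|k ih] c /=; first by move=> x _; exact: cst_continuous.
split=> [x _|v]; first exact: differentiable_cst.
have -> : 'D_v (cst c) = cst 0 by apply/funext => x; rewrite derive_cst.
exact: ih.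
Qed.

Lemma C_kD (W : normedModType R) k (U : set V) (f g : V -> W) : open U ->
  C_k k U f -> C_k k U g -> C_k k U (f + g).
Proof.
move=> oU; elim: k f g => [|k ih] f g /=.
  move=> cf cg x Ux; exact: (continuousD (cf x Ux) (cg x Ux)).
move=> [df Df] [dg Dg]; split=> [x Ux|v].
  by apply: differentiableD; [exact: df|exact: dg].
apply: C_k_ext (ih _ _ (Df v) (Dg v)) => // x; rewrite inE => Ux.
by rewrite deriveD//; apply: diff_derivable; [exact: df|exact: dg].
Qed.

Lemma C_k_linear (W W' : normedModType R) (L : W -> W') k (U : set V) (f : V -> W) :
  open U -> linear L -> continuous L -> C_k k U f -> C_k k U (L \o f).
Proof.
move=> oU lL cL; pose L' := linear_of lL.
have dL y : differentiable L y by exact: (@linear_differentiable _ _ _ L' y cL).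
elim: k f => [|k ih] f /=.
  by move=> cf x Ux; apply: continuous_comp; [exact: cf|exact: cL].
move=> [df Df]; split=> [x Ux|v].
  by apply: differentiable_comp; [exact: df|exact: dL].
apply: C_k_ext (ih _ (Df v)) => // x; rewrite inE => Ux.
have dfx := df x Ux.
have E : 'd L (f x) = L :> (W -> W') := diff_lin (f := L') (f x) cL.
rewrite deriveE; last exact: differentiable_comp.
by rewrite (diff_comp dfx (dL _)) /= E -deriveE.
Qed.

Lemma C_k_linear_mx m n p q (L : 'M[R]_(m, n) -> 'M[R]_(p, q)) k (U : set V)
    (f : V -> 'M[R]_(m, n)) :
  open U -> linear L -> C_k k U f -> C_k k U (L \o f).
Proof. by move=> oU lL; apply: C_k_linear => //; exact: mx_linear_continuous. Qed.

Lemma C_k_sum (W : normedModType R) (I : Type) (r : seq I) k (U : set V)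
    (f : I -> V -> W) : open U ->
  (forall i, C_k k U (f i)) -> C_k k U (fun x => \sum_(i <- r) f i x).
Proof.
move=> oU Cf; elim: r => [|i r ih].
  by apply: C_k_ext (C_k_cst k U 0) => // x _; rewrite big_nil.
by apply: C_k_ext (C_kD oU (Cf i) ih) => // x _; rewrite big_cons.
Qed.

Lemma C_kM k (U : set V) (f g : V -> R) : open U ->
  C_k k U f -> C_k k U g -> C_k k U (f * g).
Proof.
move=> oU; elim: k f g => [|k ih] f g.
  by move=> cf cg x Ux; exact: (continuousM (cf x Ux) (cg x Ux)).
move=> Cf Cg; have Cf' := C_kW Cf; have Cg' := C_kW Cg.
move: Cf Cg => [df Df] [dg Dg]; split=> [x Ux|v].
  by apply: differentiableM; [exact: df|exact: dg].
apply: C_k_ext (C_kD oU (ih _ _ Cf' (Dg v)) (ih _ _ Cg' (Df v))) => // x.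
rewrite inE => Ux.
by rewrite deriveM//; apply: diff_derivable; [exact: df|exact: dg].
Qed.

(** Entrywise, a product of matrices is a sum of products of real functions. *)
Lemma C_k_mulmx m n p k (U : set V) (f : V -> 'M[R]_(m, n)) (g : V -> 'M[R]_(n, p)) :
  open U -> C_k k U f -> C_k k U g -> C_k k U (fun x => f x *m g x).
Proof.
move=> oU Cf Cg.
have Ce q l (h : V -> 'M[R]_(q, l)) i j : C_k k U h -> C_k k U (fun x => h x i j).
  move=> Ch; apply: (C_k_linear (L := fun M : 'M[R]_(q, l) => M i j)) Ch => //.
    by move=> c A B; rewrite !mxE.
  exact: coord_continuous.
have Cz (h : V -> R) (E : 'M[R]_(m, p)) : C_k k U h -> C_k k U (fun x => h x *: E).
  move=> Ch; apply: (C_k_linear (L := fun c : R => c *: E)) Ch => //.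
    by move=> c a b; rewrite scalerDl scalerA.
  exact: scalel_continuous.
pose h x := \sum_i \sum_j (\sum_l f x i l * g x l j) *: delta_mx i j : 'M[R]_(m, p).
apply: (@C_k_ext _ k U h) => //.
  by move=> x _; rewrite [RHS]matrix_sum_delta; do 2!apply: eq_bigr => ? _; rewrite mxE.
do 2!(apply: C_k_sum => // ?); apply: Cz; apply: C_k_sum => // l.
by apply: C_kM => //; exact: Ce.
Qed.

(** Induction on [k], for matrices of all sizes at once: the derivative of the
    composite along [v] is a corner of the same power series at the block matrix
    built from [B] and ['D_v B], which is one degree less smooth than [B].  The
    derivative is linear in the direction, so ['D_v B] may be scaled by a small
    [e] to keep the block matrix inside the domain of convergence. *)
Lemma C_k_mxpser m (a : nat -> R) (rho : R) k (U : set V) (B : V -> 'M[R]_m) :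
  summable_at a rho -> open U -> C_k k U B ->
  (forall x, U x -> exists r : R, [/\ 0 <= r, r < rho & rowbd r (B x)]) ->
  C_k k U (mxpser a \o B).
Proof.
move=> sa; elim: k m U B => [|k ih] m U B oU CB bB.
  move=> x Ux; have [r [r0 rrho rB]] := bB x Ux.
  apply: continuous_comp; first exact: CB.
  by apply: differentiable_continuous; have [] := mxpser_differentiable sa r0 rrho rB.
have CB' := C_kW CB; case: CB => dB DB; split=> [x Ux|v].
  have [r [r0 rrho rB]] := bB x Ux.
  apply: differentiable_comp; first exact: dB.
  by have [] := mxpser_differentiable sa r0 rrho rB.
pose D := 'D_v B; apply: C_k_local => x0 Ux0.
have [r [r0 rrho rB]] := bB x0 Ux0.
pose c := m%:R * `|D x0| + 1; have c0 : 0 < c by rewrite ltr_wpDl// mulr_ge0.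
(* chosen so that [e *: D x0] has row sums at most half of what is left of the radius *)
pose e := (rho - r) / 2 / c.
have e0 : 0 < e by rewrite !divr_gt0// subr_gt0.
pose F x := dblock (B x) (e *: D x).
pose r1 := r + (rho - r) / 2; pose r2 := r1 + (rho - r) / 4.
have F0 : rowbd r1 (F x0).
  apply: rowbd_block => //; first by rewrite divr_ge0// subr_ge0 ltW.
  apply: rowbd_le (rowbdZ e (rowbd_norm (D x0))).
  rewrite gtr0_norm// /e mulrAC ler_pdivrMr// ler_wpM2l ?lerDl//.
  by rewrite divr_ge0// subr_ge0 ltW.
have CF : C_k k U F.
  pose L1 (X : 'M[R]_m) := dblock X 0; pose L2 (X : 'M[R]_m) := dblock 0 (e *: X).
  have lL1 : linear L1.
    by move=> t X Y; rewrite /L1 /dblock scale_block_mx add_block_mx !scaler0 !addr0.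
  have lL2 : linear L2.
    move=> t X Y; rewrite /L2 /dblock scale_block_mx add_block_mx !scaler0 !addr0.
    by rewrite scalerDr !scalerA (mulrC t).
  apply: C_k_ext (C_kD oU (C_k_linear_mx oU lL1 CB') (C_k_linear_mx oU lL2 (DB v))) => //.
  by move=> x _; rewrite !fctE /= /L1 /L2 /F /dblock add_block_mx !addr0 !add0r.
have r12 : r1 < r2 by rewrite /r2 ltrDl divr_gt0// subr_gt0.
have r2rho : r2 < rho by rewrite /r2 /r1; lra.
have r20 : 0 <= r2 by rewrite /r2 /r1; lra.
pose N := U `&` [set x | rowbd r2 (F x)]°.
have oN : open N by apply: openI => //; exact: open_interior.
have FN x : N x -> rowbd r2 (F x) by move=> [_ /interior_subset].
exists N.
  split=> //; apply: (C_k_continuous CF Ux0); exact: near_rowbd F0.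
have NU : N `<=` U by move=> x [].
have bN x : N x -> exists r : R, [/\ 0 <= r, r < rho & rowbd r (F x)].
  by move=> Nx; exists r2; split=> //; exact: FN.
have := ih _ N F oN (C_k_subset NU CF) bN.
pose L (X : 'M[R]_(m + m)) := e^-1 *: ursubmx X.
have lL : linear L.
  move=> t X Y; rewrite /L ursubmx_linear scalerDr !scalerA [_ * t]mulrC //.
move=> /(C_k_linear_mx oN lL); apply: C_k_ext => // x; rewrite inE => Nx.
have [s [s0 srho sB]] := bB x (NU x Nx).
have [dp Ep] := mxpser_differentiable sa s0 srho sB.
have dBx := dB x (NU x Nx).
rewrite deriveE; last exact: differentiable_comp.
rewrite (diff_comp dBx dp) /= Ep -deriveE// -/D.
have lD := mxpser_diff_linear sa s0 srho sB.
have E : mxpser_diff a (B x) (e *: D x) = ursubmx (mxpser a (F x)).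
  apply: lim_series_mx.
  have := linear_series (@ursubmx_linear R m m m m) (mxpser_cvg sa r20 r2rho (FN x Nx)).
  have <- : (fun l => a l *: dpow (B x) (e *: D x) l) = fun l => ursubmx (a l *: F x ^+ l).
    by apply/funext => l; apply/matrixP => i j; rewrite !mxE.
  by [].
rewrite /L -E -[mxpser_diff _ _ (e *: _)]/(linear_of lD _) linearZ /=.
by rewrite scalerA mulVf ?scale1r// gt_eqF.
Qed.

End Smoothness.

(** * The spectral theorem for an inner product *)

Section Spectral.
Context {R : realType}.

(** Matrices act on row vectors, so [G] is the inner product
    [<u, v> = u G v^T]. *)
Definition posdef n (G : 'M[R]_n) :=
  G^T = G /\ forall u : 'rV[R]_n, u != 0 -> 0 < (u *m G *m u^T) 0 0.

(** [<u A, v> = <u, v A>] for the inner product with matrix [G]. *)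
Definition selfadj n (G A : 'M[R]_n) := A *m G = G *m A^T.

Lemma posdef_ge0 n (G : 'M[R]_n) (u : 'rV[R]_n) :
  posdef G -> 0 <= (u *m G *m u^T) 0 0.
Proof.
move=> [_ Gp]; have [->|/Gp/ltW//] := eqVneq u 0.
by rewrite !mul0mx mxE.
Qed.

Lemma posdef_eq0 n (G : 'M[R]_n) (u : 'rV[R]_n) :
  posdef G -> u *m G *m u^T = 0 -> u = 0.
Proof.
move=> [_ Gp] E; apply/eqP/negPn/negP => /Gp.
by rewrite E mxE ltxx.
Qed.

Lemma posdef_unit n (G : 'M[R]_n) : posdef G -> G \in unitmx.
Proof.
move=> Gp; rewrite -row_free_unit; apply: inj_row_free => v vG.
by apply: (posdef_eq0 Gp); rewrite vG mul0mx.
Qed.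

(** If [T^(2k) = 0] then [<u T^k, u T^k> = <u, u T^(2k)> = 0], so [T^k = 0]. *)
Lemma selfadj_nilpotent n (G T : 'M[R]_n) N :
  posdef G -> selfadj G T -> T ^+ N = 0 -> T = 0.
Proof.
move=> Gp ST; have SX k : selfadj G (T ^+ k).
  elim: k => [|k ih]; first by rewrite /selfadj expr0 trmx1 mul1mx mulmx1.
  by rewrite /selfadj exprS -!mulmxE -mulmxA ih mulmxA ST -mulmxA -trmx_mul mulmxE -exprSr exprS.
case: N => [|N]; first by rewrite expr0 => T0; rewrite -[T]mulr1 T0 mulr0.
elim: N => [|N ih] TN; first by rewrite -[T]expr1.
apply: ih; have := SX N.+1; set S := T ^+ N.+1 => SS.
have S2 : S *m S = 0.
  have -> : S *m S = T ^+ N.+2 * T ^+ N.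
    by rewrite mulmxE /S -!exprD !addSn !addnS.
  by rewrite TN mul0r.
apply/row_matrixP => i; rewrite row0; apply: (posdef_eq0 Gp).
rewrite rowE trmx_mul !mulmxA -[X in X *m _]mulmxA -SS mulmxA.
by rewrite -(mulmxA (delta_mx 0 i)) S2 mulmx0 !mul0mx.
Qed.

Local Notation toC := (real_complex R).

(** Write a complex eigenvector as [a + i b].  Self-adjointness gives
    [<a A, b> = <a, b A>], which reads [Im z (<a, a> + <b, b>) = 0]. *)
Lemma selfadj_eigen_real n (G A : 'M[R]_n) (z : R[i]) : posdef G -> selfadj G A ->
  eigenvalue (map_mx toC A) z -> z = toC (complex.Re z).
Proof.
move=> Gp SA /eigenvalueP[v vA v0].
pose a := map_mx (@complex.Re R) v; pose b := map_mx (@complex.Im R) v.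
have ReD : {morph @complex.Re R : x y / x + y >-> x + y} by move=> [? ?] [? ?].
have ImD : {morph @complex.Im R : x y / x + y >-> x + y} by move=> [? ?] [? ?].
have aA : a *m A = complex.Re z *: a - complex.Im z *: b.
  apply/rowP => j; have /rowP/(_ j) := vA; rewrite !mxE => /(congr1 (@complex.Re R)).
  rewrite (big_morph _ ReD (erefl _)) => E.
  transitivity (complex.Re (z * v 0 j)).
    rewrite -E; apply: eq_bigr => k _; rewrite !mxE.
    by case: (v 0 k) => x y /=; rewrite mulr0 subr0.
  by case: (v 0 j) => x y; case: (z) => x' y'.
have bA : b *m A = complex.Im z *: a + complex.Re z *: b.
  apply/rowP => j; have /rowP/(_ j) := vA; rewrite !mxE => /(congr1 (@complex.Im R)).
  rewrite (big_morph _ ImD (erefl _)) => E.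
  transitivity (complex.Im (z * v 0 j)).
    rewrite -E; apply: eq_bigr => k _; rewrite !mxE.
    by case: (v 0 k) => x y /=; rewrite mulr0 add0r.
  by case: (v 0 j) => x y; case: (z) => x' y' /=; rewrite addrC.
have E : complex.Im z *: (a *m G *m a^T + b *m G *m b^T) = 0.
  have : a *m A *m G *m b^T = a *m G *m (b *m A)^T.
    by rewrite trmx_mul -(mulmxA a) SA !mulmxA.
  rewrite aA bA mulmxBl mulmxBl linearD !linearZ /= mulmxDr -!scalemxAl -!scalemxAr.
  by rewrite [RHS]addrC => /addrI E; rewrite scalerDr -E addNr.
have ab : 0 < (a *m G *m a^T + b *m G *m b^T) 0 0.
  have [a0|/Gp.2 a0] := eqVneq a 0; last first.
    by rewrite mxE ltr_pwDl// posdef_ge0.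
  rewrite a0 !mul0mx add0r; apply: Gp.2; apply: contra v0 => /eqP b0.
  apply/eqP/rowP => j; move/rowP/(_ j): a0; move/rowP/(_ j): b0; rewrite !mxE.
  by case: (v 0 j) => x y /= -> ->.
have : complex.Im z = 0.
  move/matrixP/(_ 0 0): E; rewrite [LHS]mxE [RHS]mxE => /eqP.
  by rewrite mulf_eq0 (gt_eqF ab) orbF => /eqP.
by case: (z) => x y /= ->.
Qed.

Lemma selfadj_horner n (G A : 'M[R]_n.+1) (p : {poly R}) :
  selfadj G A -> selfadj G (horner_mx A p).
Proof.
move=> SA; rewrite /selfadj; elim/poly_ind: p => [|p c ih].
  by rewrite !rmorph0 trmx0 mul0mx mulmx0.
rewrite !rmorphD !rmorphM /= horner_mx_X horner_mx_C linearD /=.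
rewrite -!mulmxE trmx_mul mulmxDl mulmxDr tr_scalar_mx mul_scalar_mx mul_mx_scalar.
congr (_ + _).
have cA : horner_mx A p *m A = A *m horner_mx A p.
  by rewrite mulmxE; apply: comm_horner_mx.
by rewrite cA -mulmxA ih !mulmxA SA.
Qed.

Definition diagonalized n (A Q : 'M[R]_n) (d : 'rV[R]_n) :=
  Q \in unitmx /\ A = invmx Q *m diag_mx d *m Q.

Definition rdiag n (A : 'M[R]_n) := exists Q d, diagonalized A Q d.

(** The characteristic polynomial splits over the reals since the complex
    eigenvalues are real.  Let [q] be the product of its distinct linear factors;
    the characteristic polynomial divides a power of [q], so [q] of [A] is
    nilpotent by Cayley-Hamilton, and self-adjoint, hence zero.  So the minimal polynomial
    has simple real roots. *)
Theorem spectral n (G A : 'M[R]_n) : posdef G -> selfadj G A -> rdiag A.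
Proof.
case: n => [|n] in G A * => Gp SA.
  exists 1%:M, 0; split; first exact: unitmx1.
  by apply/matrixP => -[].
have [r rE] := closed_field_poly_normal (char_poly (map_mx toC A)).
rewrite (monicP (char_poly_monic _)) scale1r in rE.
pose s := map (@complex.Re R) r.
have rs : r = map toC s.
  rewrite /s -map_comp -[LHS]map_id; apply/eq_in_map => z zr /=.
  apply: (selfadj_eigen_real Gp SA).
  by rewrite eigenvalue_root_char rE root_prod_XsubC.
have pE : char_poly A = \prod_(x <- s) ('X - x%:P).
  apply: (map_poly_inj toC); rewrite map_char_poly rE rs big_map rmorph_prod /=.
  by apply: eq_bigr => x _; rewrite rmorphB /= map_polyX map_polyC.
pose q := \prod_(x <- undup s) ('X - x%:P).
have pq : char_poly A %| q ^+ size s.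
  have qs x : x \in s -> 'X - x%:P %| q.
    by rewrite -mem_undup => xs; rewrite dvdp_XsubCl /root; rewrite -/(root _ _) root_prod_XsubC.
  rewrite pE; elim: (s) qs => [|x t ih] qs; first by rewrite big_nil dvd1p.
  rewrite big_cons exprS dvdp_mul ?qs ?mem_head// ih// => y yt.
  by rewrite qs// inE yt orbT.
have q0 : horner_mx A q = 0.
  apply: (selfadj_nilpotent (N := size s) Gp); first exact: selfadj_horner.
  rewrite -rmorphXn; have /dvdpP[t ->] := pq.
  by rewrite rmorphM /= Cayley_Hamilton mulr0.
have /diagonalizableP[Q Qu /(diagonalizable_forLR Qu)[d AE]] :
    exists2 rs, uniq rs & mxminpoly A %| \prod_(x <- rs) ('X - x%:P).
  by exists (undup s); [exact: undup_uniq|exact: mxminpoly_min].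
by exists Q, d; split=> //; rewrite AE mxpoly.conjVmx.
Qed.

End Spectral.

(** * Exponential and logarithm of diagonalizable matrices *)

Section Exponential.
Context {R : realType}.

Lemma exprmx_conj n (Q B : 'M[R]_n) k : Q \in unitmx ->
  (invmx Q *m B *m Q) ^+ k = invmx Q *m B ^+ k *m Q.
Proof.
move=> Qu; elim: k => [|k ih]; first by rewrite !expr0 mulmx1 mulVmx.
by rewrite !exprS ih -!mulmxE !mulmxA mulmxK.
Qed.

Lemma diag_mxX n (d : 'rV[R]_n) k : diag_mx d ^+ k = diag_mx (map_mx (fun x => x ^+ k) d).
Proof.
elim: k => [|k ih].
  by rewrite expr0 -[1]/(1%:M) -diag_const_mx; congr diag_mx; apply/rowP => j; rewrite !mxE.
rewrite exprS ih -mulmxE mulmx_diag; congr diag_mx; apply/rowP => j.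
by rewrite !mxE exprS.
Qed.

Lemma mxpser_diagonalized n (a : nat -> R) (A Q : 'M[R]_n) (d : 'rV[R]_n) :
  diagonalized A Q d ->
  (forall j, cvgn (series (fun k => a k * d 0 j ^+ k))) ->
  diagonalized (mxpser a A) Q (\row_j limn (series (fun k => a k * d 0 j ^+ k))).
Proof.
move=> [Qu AE] cd; split=> //; set e := \row_j _.
have De : series (fun k => a k *: diag_mx d ^+ k) @ \oo --> diag_mx e.
  apply: cvg_mx => i j; under eq_cvg do rewrite series_mxE.
  rewrite [diag_mx e i j]mxE; have [->|ij] := eqVneq i j.
    rewrite mulr1n mxE.
    have -> : (fun k => (a k *: diag_mx d ^+ k) j j) = (fun k => a k * d 0 j ^+ k).
      by apply/funext => k; rewrite diag_mxX !mxE eqxx.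
    exact: cd.
  have -> : series (fun k => (a k *: diag_mx d ^+ k) i j) = cst 0.
    apply/funext => k; rewrite /series /= big1// => l _.
    by rewrite diag_mxX !mxE (negPf ij) mulr0n mulr0.
  exact: cvg_cst.
pose f (X : 'M[R]_n) := invmx Q *m X *m Q.
have lf : linear f.
  by move=> c X Y; rewrite /f mulmxDr mulmxDl -scalemxAr -scalemxAl.
apply: lim_series_mx; have := linear_series lf De.
have -> : (fun k => f (a k *: diag_mx d ^+ k)) = fun k => a k *: A ^+ k.
  by apply/funext => k; rewrite AE exprmx_conj// /f -scalemxAr -scalemxAl.
by [].
Qed.

Definition expcoef (k : nat) : R := (k`!%:R)^-1.

Definition mexp n (A : 'M[R]_n) : 'M[R]_n := mxpser expcoef A.

Lemma summable_expcoef {rho : R} : summable_at expcoef rho.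
Proof.
rewrite /summable_at.
have -> : (fun k => `|expcoef k| * rho ^+ k) = exp_coeff rho.
  by rewrite exp_coeffE; apply/funext => k; rewrite /expcoef ger0_norm.
exact: is_cvg_series_exp_coeff.
Qed.

Lemma mexp_cvg n (A : 'M[R]_n) :
  series (fun k => expcoef k *: A ^+ k) @ \oo --> mexp A.
Proof.
apply: (mxpser_cvg (@summable_expcoef (n%:R * `|A| + 1)) _ _ (rowbd_norm A)).
  by rewrite mulr_ge0.
by rewrite ltrDl.
Qed.

(** With [C] square and invertible this is invariance under conjugation; with [C]
    a bilinear form it says that adjoints commute with the exponential. *)
Lemma mexp_intertwine p q (A : 'M[R]_p) (B : 'M[R]_q) (C : 'M[R]_(p, q)) :
  A *m C = C *m B -> mexp A *m C = C *m mexp B.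
Proof.
move=> AC.
have lr : linear (fun X : 'M[R]_p => X *m C).
  by move=> c X Y; rewrite mulmxDl -scalemxAl.
have ll : linear (fun X : 'M[R]_q => C *m X).
  by move=> c X Y; rewrite mulmxDr -scalemxAr.
have h1 := linear_series lr (@mexp_cvg p A).
have h2 := linear_series ll (@mexp_cvg q B).
have E : (fun k => (expcoef k *: A ^+ k) *m C) = fun k => C *m (expcoef k *: B ^+ k).
  apply/funext => k; rewrite -scalemxAl -scalemxAr; congr (_ *: _).
  elim: k => [|k ih]; first by rewrite !expr0 mul1mx mulmx1.
  by rewrite (exprS A) (exprS B) -!mulmxE -mulmxA ih !mulmxA AC.
rewrite E in h1; exact: cvg_unique h1 h2.
Qed.

Lemma trmx_mexp n (A : 'M[R]_n) : (mexp A)^T = mexp A^T.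
Proof.
have lt : linear (trmx : 'M[R]_n -> 'M[R]_n) by move=> c X Y; rewrite linearP.
have h := linear_series lt (@mexp_cvg n A).
apply/esym/lim_series_mx; move: h.
have -> // : (fun k => (expcoef k *: A ^+ k)^T) = fun k => expcoef k *: A^T ^+ k.
apply/funext => k; rewrite linearZ /=; congr (_ *: _).
elim: k => [|k ih]; first by rewrite !expr0 trmx1.
by rewrite exprSr -mulmxE trmx_mul ih exprS.
Qed.

Lemma mexp_diagonalized n (A Q : 'M[R]_n) d :
  diagonalized A Q d -> diagonalized (mexp A) Q (map_mx expR d).
Proof.
move=> AQ; have e j : (fun k => expcoef k * d 0 j ^+ k) = exp_coeff (d 0 j).
  by rewrite exp_coeffE.
have := mxpser_diagonalized (a := expcoef) AQ.
have -> : \row_j limn (series (fun k => expcoef k * d 0 j ^+ k)) = map_mx expR d.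
  by apply/rowP => j; rewrite !mxE e.
by apply=> j; rewrite e; exact: is_cvg_series_exp_coeff.
Qed.

Lemma diagonalizedM n (A B Q : 'M[R]_n) d e : diagonalized A Q d ->
  diagonalized B Q e -> diagonalized (A *m B) Q (\row_j (d 0 j * e 0 j)).
Proof.
move=> [Qu ->] [_ ->]; split=> //.
rewrite !mulmxA mulmxK// -(mulmxA _ (diag_mx d) (diag_mx e)) mulmx_diag.
by congr (_ *m _ *m _); congr diag_mx; apply/rowP => j; rewrite !mxE.
Qed.

Lemma diagonalizedZ n (A Q : 'M[R]_n) d c :
  diagonalized A Q d -> diagonalized (c *: A) Q (c *: d).
Proof.
move=> [Qu ->]; split=> //.
by rewrite linearZ /= -scalemxAr -scalemxAl.
Qed.

Lemma diagonalized_inj n (A B Q : 'M[R]_n) d :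
  diagonalized A Q d -> diagonalized B Q d -> A = B.
Proof. by move=> [_ ->] [_ ->]. Qed.

Lemma diagonalizedD n (A B Q : 'M[R]_n) d e : diagonalized A Q d ->
  diagonalized B Q e -> diagonalized (A + B) Q (d + e).
Proof.
move=> [Qu ->] [_ ->]; split=> //.
by rewrite linearD /= mulmxDr mulmxDl.
Qed.

Lemma diagonalized_scalar n (Q : 'M[R]_n) c : Q \in unitmx ->
  diagonalized c%:M Q (const_mx c).
Proof.
move=> Qu; split=> //.
by rewrite diag_const_mx mul_mx_scalar -scalemxAl mulVmx// scalemx1.
Qed.

Lemma diagonalized_row n (A Q : 'M[R]_n) d j : diagonalized A Q d ->
  row j Q != 0 /\ row j Q *m A = d 0 j *: row j Q.
Proof.
move=> [Qu ->]; split; last first.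
  rewrite !mulmxA -row_mul mulmxV// -row_mul mul1mx row_diag_mx.
  by rewrite -scalemxAl -rowE.
apply/eqP => q0; have /rowP/(_ j) : delta_mx 0 j = 0 :> 'rV[R]_n.
  by rewrite -[LHS](mulmxK Qu) -rowE q0 mul0mx.
by rewrite !mxE !eqxx => /eqP; rewrite oner_eq0.
Qed.

Lemma mexpN n (A : 'M[R]_n) : rdiag A -> mexp A *m mexp (- A) = 1%:M.
Proof.
move=> [Q [d AQ]]; have [Qu _] := AQ; rewrite -scaleN1r.
have := diagonalizedM (mexp_diagonalized AQ) (mexp_diagonalized (diagonalizedZ (-1) AQ)).
set e := \row_j _; have -> : e = const_mx 1.
  by apply/rowP => j; rewrite !mxE mulN1r expRN divff// gt_eqF// expR_gt0.
by move=> h; exact: diagonalized_inj h (diagonalized_scalar 1 Qu).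
Qed.

Lemma mexp_half n (A : 'M[R]_n) : rdiag A ->
  mexp (2^-1 *: A) *m mexp (2^-1 *: A) = mexp A.
Proof.
move=> [Q [d AQ]].
have AQ2 := mexp_diagonalized (diagonalizedZ 2^-1 AQ).
have := diagonalizedM AQ2 AQ2.
set e := \row_j _; have -> : e = map_mx expR d.
  by apply/rowP => j; rewrite !mxE -expRD mulrC -splitr.
by move=> h; exact: diagonalized_inj h (mexp_diagonalized AQ).
Qed.

(** In eigenbases of [A] and [B], the change of basis [T] intertwines the
    exponentials: an entry of [T] can only be nonzero when the exponentials of the two
    eigenvalues agree, that is, when the eigenvalues agree.  So [T] already
    intertwines the diagonal forms of [A] and [B]. *)
Lemma mexp_inj n (A B : 'M[R]_n) : rdiag A -> rdiag B -> mexp A = mexp B -> A = B.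
Proof.
move=> [Q [d AQ]] [U [e BU]] E.
have [Qu AE] := AQ; have [Uu BE] := BU.
have [_ eA] := mexp_diagonalized AQ; have [_ eB] := mexp_diagonalized BU.
pose T := Q *m invmx U.
have ET : diag_mx (map_mx expR d) *m T = T *m diag_mx (map_mx expR e).
  have := E; rewrite eA eB => /(congr1 (fun X => Q *m X *m invmx U)).
  by rewrite !mulmxA mulmxV// mul1mx mulmxK// /T mulmxA.
have DT : diag_mx d *m T = T *m diag_mx e.
  apply/matrixP => i j; move/matrixP/(_ i j): ET.
  rewrite !mul_diag_mx !mul_mx_diag !mxE [RHS]mulrC => /eqP.
  rewrite -subr_eq0 -mulrBl mulf_eq0 subr_eq0 => /orP[/eqP/expR_inj ->|/eqP ->].
    exact: mulrC.
  by rewrite mulr0 mul0r.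
have QT : Q = T *m U by rewrite /T mulmxKV.
rewrite AE BE {2}QT mulmxA -(mulmxA _ _ T) DT /T !mulmxA mulVmx//.
by rewrite mul1mx.
Qed.

Definition pdiag n (A : 'M[R]_n) :=
  exists Q d, diagonalized A Q d /\ forall j, 0 < d 0 j.

Lemma mexp_surj n (A : 'M[R]_n) : pdiag A -> exists2 Y, rdiag Y & mexp Y = A.
Proof.
move=> [Q [d [AQ d0]]]; have [Qu _] := AQ.
pose Y := invmx Q *m diag_mx (map_mx (@ln R) d) *m Q.
have YQ : diagonalized Y Q (map_mx (@ln R) d) by [].
exists Y; first by exists Q, (map_mx (@ln R) d).
have := mexp_diagonalized YQ; have -> : map_mx expR (map_mx (@ln R) d) = d.
  by apply/rowP => j; rewrite !mxE lnK// posrE.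
by move=> h; exact: diagonalized_inj h AQ.
Qed.

(** By [mexp_inj], the only diagonalizable logarithm, when there is one. *)
Definition mlog n (A : 'M[R]_n) : 'M[R]_n := xget 0 [set Y | rdiag Y /\ mexp Y = A].

Lemma mlogK n (Y : 'M[R]_n) : rdiag Y -> mlog (mexp Y) = Y.
Proof.
move=> rY.
have /(@xgetPex _ 0)[rZ /mexp_inj] : exists Z, [set Z | rdiag Z /\ mexp Z = mexp Y] Z.
  by exists Y.
exact.
Qed.

Lemma is_derive_ln_rem (n : nat) (t : R) : t < 1 ->
  is_derive t 1 (fun t => ln (1 - t) + \sum_(0 <= k < n.+1) t ^+ k / k%:R)
    (- t ^+ n / (1 - t)).
Proof.
move=> t1; elim: n => [|n ih].
  have -> : (fun t : R => ln (1 - t) + \sum_(0 <= k < 1) t ^+ k / k%:R) =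
      (@ln R) \o (fun t => 1 - t).
    by apply/funext => x; rewrite big_nat1 /= invr0 mulr0 addr0.
  have h1 : is_derive (1 - t) 1 (@ln R) (1 - t)^-1.
    by apply: is_derive1_ln; rewrite subr_gt0.
  have h2 : is_derive t 1 (fun t : R => 1 - t) (0 - 1) by exact: is_deriveB.
  have := @is_derive1_comp R (@ln R) (fun t => 1 - t) t _ _ h1 h2.
  by rewrite sub0r mulrN1 expr0 mulN1r.
have -> : (fun t : R => ln (1 - t) + \sum_(0 <= k < n.+2) t ^+ k / k%:R) =
   (fun t : R => ln (1 - t) + \sum_(0 <= k < n.+1) t ^+ k / k%:R) +
   (fun t : R => (n.+1%:R)^-1 *: t ^+ n.+1).
  by apply/funext => x; rewrite [LHS]/= big_nat_recr //= addrA !fctE [_ *: _]mulrC.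
have hX : is_derive t 1 ((@id R) ^+ n.+1) ((n.+1%:R * t ^+ n) *: 1) by exact: is_deriveX.
have h : is_derive t 1 (fun t : R => (n.+1%:R)^-1 *: t ^+ n.+1) (t ^+ n).
  have -> : (fun t : R => (n.+1%:R)^-1 *: t ^+ n.+1) = (n.+1%:R)^-1 *: ((@id R) ^+ n.+1).
    by apply/funext => x; rewrite fctE.
  apply: is_derive_eq (is_deriveZ _ hX) _.
  by rewrite /GRing.scale /= mulr1 mulKf.
apply: is_derive_eq (is_deriveD ih h) _.
by rewrite exprS; field; lra.
Qed.

(** The sum on the left has derivative [- t^n / (1 - t)]; the bound is the mean
    value theorem on the segment from [0] to [x], which is parametrized by
    [0, 1] so that the sign of [x] does not matter. *)
Lemma ln_rem_bound n (x : R) : `|x| < 1 ->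
  `|ln (1 - x) + \sum_(0 <= k < n.+1) x ^+ k / k%:R| <= `|x| ^+ n / (1 - `|x|).
Proof.
move=> x1; set f := fun t : R => ln (1 - t) + \sum_(0 <= k < n.+1) t ^+ k / k%:R.
pose g (t : R) := t * x.
have tx t : t \in `[(0:R), 1] -> `|g t| <= `|x| /\ g t < 1.
  rewrite in_itv /= => /andP[t0 t1]; have tx : `|g t| <= `|x|.
    by rewrite normrM (ger0_norm t0) ler_piMl.
  by split=> //; apply: le_lt_trans (ler_norm _) (le_lt_trans tx x1).
have der t : t \in `[(0:R), 1] -> is_derive t 1 (f \o g) (- g t ^+ n / (1 - g t) * x).
  move=> /tx[_ t1].
  have hM : is_derive t 1 g x.
    have -> : g = x *: (@id R) by apply/funext => u; rewrite fctE /g mulrC.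
    by apply: is_derive_eq (is_deriveZ _ (is_derive_id _ _)) _; rewrite /GRing.scale /= mulr1.
  have h : is_derive (g t) 1 f (- g t ^+ n / (1 - g t)) := is_derive_ln_rem n t1.
  exact: (@is_derive1_comp R f g t _ _ h hM).
pose df (t : R) : R := - g t ^+ n / (1 - g t) * x.
have der' (t : R) : t \in `]0, 1[%R -> is_derive t 1 (f \o g) (df t).
  by move=> t01; apply: der; exact: subset_itv_oo_cc t01.
have cont : {within `[(0:R), 1], continuous (f \o g)}.
  by apply: derivable_within_continuous => t /der[].
have [c /tx[c1 c2] E] := MVT_segment (@ler01 R) der' cont.
have f0 : f (g 0) = 0.
  rewrite /f /g mul0r subr0 ln1 add0r big_nat_recl//= invr0 mulr0 add0r.
  by rewrite big1// => i _; rewrite exprS !mul0r.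
rewrite [(f \o g) 0]f0 !subr0 mulr1 in E.
have -> : ln (1 - x) + \sum_(0 <= k < n.+1) x ^+ k / k%:R = (f \o g) 1.
  by rewrite /= /g mul1r.
rewrite E /df !normrM normrN normfV normrX.
have x0 : 0 < 1 - `|x| by rewrite subr_gt0.
have gx : 1 - `|x| <= `|1 - g c|.
  apply: le_trans (ler_norm _); rewrite lerD2l lerN2.
  exact: le_trans (ler_norm _) c1.
rewrite -[leRHS]mulr1 ler_pM ?mulr_ge0 ?exprn_ge0 ?invr_ge0 ?(ltW x1)//.
by rewrite ler_pM ?exprn_ge0 ?invr_ge0// ?lerXn2r// ?lef_pV2// posrE (lt_le_trans x0 gx).
Qed.

Lemma ln_series (x : R) : `|x| < 1 ->
  series (fun k => - (k%:R)^-1 * x ^+ k) @ \oo --> ln (1 - x).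
Proof.
move=> x1; rewrite -cvg_shiftS; apply/cvgrPdist_le => e e0.
have nx1 : `| `|x| | < 1 by rewrite normr_id.
have /cvgrPdist_le/(_ _ e0) := cvg_geometric (1 - `|x|)^-1 nx1.
apply: filterS => n; rewrite sub0r normrN => h.
apply: le_trans (le_trans (le_trans (ln_rem_bound n x1) (ler_norm _)) _); last first.
  by rewrite mulrC.
rewrite /series /= -sumrN.
under [X in _ <= `|_ + X|]eq_bigr do rewrite mulrC -[_^-1]opprK mulNr.
by [].
Qed.

Lemma invmxM n (A B : 'M[R]_n) : A \in unitmx -> B \in unitmx ->
  invmx (A *m B) = invmx B *m invmx A.
Proof.
move=> Au Bu; have ABu : A *m B \in unitmx by rewrite unitmx_mul Au.
rewrite -[RHS](mulKmx ABu) -!mulmxA mulKVmx// mulmxV// mulmx1.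
by [].
Qed.

Lemma diagonalized_conj n (A Q T : 'M[R]_n) d : T \in unitmx ->
  diagonalized A Q d -> diagonalized (invmx T *m A *m T) (Q *m T) d.
Proof.
move=> Tu [Qu ->]; split; first by rewrite unitmx_mul Qu.
by rewrite invmxM// !mulmxA.
Qed.

Lemma diagonalized_rowbd n (A Q : 'M[R]_n) d r j :
  diagonalized A Q d -> rowbd r A -> `|d 0 j| <= r.
Proof.
move=> AQ rA; have [q0 qA] := diagonalized_row j AQ; set q := row j Q in q0 qA.
have r0 : 0 <= r by apply: le_trans (rA j); apply: sumr_ge0.
pose s := \sum_k `|q 0 k|.
have sq : rowbd s q by move=> i; rewrite ord1.
(* compare the row sums of both sides of the eigenvector equation *)
have := rowbdM r0 sq rA 0; rewrite qA.
under eq_bigr do rewrite mxE normrM.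
rewrite -mulr_sumr -/s mulrC ler_pM2l// lt_neqAle sumr_ge0// andbT eq_sym.
rewrite psumr_eq0//; apply: contra q0 => /allP q0; apply/eqP/rowP => k.
by rewrite [RHS]mxE; apply/eqP; rewrite -normr_eq0; apply: q0; rewrite mem_index_enum.
Qed.

(** The coefficients of [ln (1 - x)]; that of degree [0] is [0] because [0^-1 = 0]. *)
Definition logcoef (k : nat) : R := - (k%:R)^-1.

Lemma summable_logcoef (rho : R) : 0 <= rho -> rho < 1 -> summable_at logcoef rho.
Proof.
move=> rho0 rho1; rewrite /summable_at.
apply: (series_le_cvg _ _ _ (is_cvg_geometric_series (a := 1) (z := rho) _)).
- by move=> k; rewrite mulr_ge0// exprn_ge0.
- by move=> k; rewrite /geometric /= mul1r exprn_ge0.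
- move=> k; rewrite /geometric /= ler_wpM2r ?exprn_ge0// /logcoef normrN.
  case: k => [|k]; first by rewrite invr0 normr0.
  by rewrite ger0_norm// invf_le1// ler1n.
- by rewrite ger0_norm.
Qed.

(** * Smoothness of the exponential and of the logarithm *)

Section SmoothFunctionalCalculus.
Context {V : normedModType R}.

(** Near each point [B] is bounded, and the exponential series converges at
    every radius. *)
Lemma C_k_mexp k n (U : set V) (B : V -> 'M[R]_n) : open U ->
  C_k k U B -> C_k k U (fun x => mexp (B x)).
Proof.
move=> oU CB; apply: C_k_local => x0 Ux0.
pose r : R := n%:R * `|B x0|; have r0 : 0 <= r by rewrite mulr_ge0.
pose N := U `&` [set x | rowbd (r + 1) (B x)]°.
have oN : open N by apply: openI => //; exact: open_interior.
exists N.
  split=> //; apply: (C_k_continuous CB Ux0).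
  by apply: near_rowbd (rowbd_norm _); rewrite ltrDl.
change (C_k k N (mxpser expcoef \o B)).
apply: (C_k_mxpser (summable_expcoef (rho := r + 2)) oN _ _).
  by apply: C_k_subset CB => x [].
move=> x [_ /interior_subset rx]; exists (r + 1); split=> //.
  by rewrite addr_ge0.
by rewrite ltrD2l ltr1n.
Qed.

(** Near [x0], in an eigenbasis [Q] of [S x0], one has
    [log S = log c + log (1 - (1 - S / c))] for a constant [c] that exceeds all
    eigenvalues of [S x0].  In that basis [1 - S x0 / c] is diagonal with entries
    strictly between [0] and [1], so nearby it stays in the unit ball, where the series of
    [log (1 - z)] converges; it computes the logarithm since it does so on
    eigenvalues. *)
Lemma C_k_mlog k n (U : set V) (S : V -> 'M[R]_n) : open U ->
  C_k k U S -> (forall x, U x -> pdiag (S x)) -> C_k k U (fun x => mlog (S x)).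
Proof.
move=> oU CS pS; apply: C_k_local => x0 Ux0.
have [Q [d [SQ d0]]] := pS x0 Ux0; have [Qu _] := SQ.
have Qiu : invmx Q \in unitmx by rewrite unitmx_inv.
pose c := 1 + \sum_j d 0 j.
have dc j : d 0 j < c.
  rewrite /c (bigD1 j)//= addrCA ltrDl ltr_pwDl// sumr_ge0// => i _.
  exact: ltW.
have c0 : 0 < c by rewrite ltr_pwDl// sumr_ge0// => i _; exact: ltW.
pose B x := 1%:M - c^-1 *: (Q *m S x *m invmx Q).
have BD x T e : diagonalized (S x) T e ->
    diagonalized (B x) (T *m invmx Q) (const_mx 1 + (- c^-1) *: e).
  move=> /(diagonalized_conj Qiu); rewrite invmxK => h.
  rewrite /B -scaleNr; apply: diagonalizedD (diagonalizedZ _ h).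
  by apply: diagonalized_scalar; case: h.
pose r0 : R := \big[Num.max/0]_j `|1 - d 0 j / c|.
have r00 : 0 <= r0 by rewrite /r0; elim/big_ind: _ => // a b a0 b0; rewrite le_max a0.
have r01 : r0 < 1.
  apply: bigmax_lt => // j _.
  have y0 : 0 < d 0 j / c by exact: divr_gt0.
  have y1 : d 0 j / c < 1 by rewrite ltr_pdivrMr// mul1r.
  by rewrite ltr_norml; apply/andP; split; lra.
have B0 : rowbd r0 (B x0).
  have [_ ->] := BD _ _ _ SQ; rewrite mulmxV// invmx1 mul1mx mulmx1 => i.
  rewrite (bigD1 i)//= big1 ?addr0.
    rewrite mxE eqxx mulr1n !mxE mulNr (mulrC c^-1).
    exact: (le_bigmax _ (fun j => `|1 - d 0 j / c|)).
  by move=> j ji; rewrite mxE eq_sym (negPf ji) mulr0n normr0.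
pose r : R := (r0 + 1) / 2; pose rho : R := (r + 1) / 2.
have r0r : r0 < r by rewrite /r; lra.
have rrho : r < rho by rewrite /rho /r; lra.
have rho1 : rho < 1 by rewrite /rho /r; lra.
have rp : 0 <= r by rewrite (le_trans r00)// ltW.
have rhop : 0 <= rho by rewrite (le_trans rp)// ltW.
have CB : C_k k U B.
  pose L (X : 'M[R]_n) := (- c^-1) *: (Q *m X *m invmx Q).
  have lL : linear L.
    move=> t X Y; rewrite /L mulmxDr mulmxDl scalerDr -scalemxAr -scalemxAl.
    by rewrite !scalerA (mulrC t).
  apply: C_k_ext (C_kD oU (C_k_cst k U 1%:M) (C_k_linear_mx oU lL CS)) => // x _.
  by rewrite !fctE /= /L /B scaleNr.
pose N := U `&` [set x | rowbd r (B x)]°.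
have oN : open N by apply: openI => //; exact: open_interior.
exists N.
  by split=> //; apply: (C_k_continuous CB Ux0); exact: near_rowbd B0.
have CN : C_k k N (mxpser logcoef \o B).
  apply: (C_k_mxpser (summable_logcoef rhop rho1) oN _ _).
    by apply: C_k_subset CB => x [].
  by move=> x [_ /interior_subset rx]; exists r.
pose L (X : 'M[R]_n) := invmx Q *m X *m Q.
have lL : linear L.
  by move=> t X Y; rewrite /L mulmxDr mulmxDl -scalemxAr -scalemxAl.
have := C_k_linear_mx oN lL (C_kD oN (C_k_cst k N (ln c)%:M) CN).
apply: C_k_ext => // x; rewrite inE => -[Ux /interior_subset rx].
have [T [e [ST e0]]] := pS x Ux.
have BT := BD _ _ _ ST; set b := const_mx 1 + _ in BT.
have b1 j : `|b 0 j| < 1.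
  by apply: le_lt_trans (diagonalized_rowbd j BT rx) _; rewrite (lt_trans rrho).
have lb j : series (fun k => logcoef k * b 0 j ^+ k) @ \oo --> ln (1 - b 0 j).
  exact: ln_series.
have /mxpser_diagonalized := BT => /(_ logcoef).
set f := \row_j _ => /(_ (fun j => cvgP _ (lb j))) FT.
have := diagonalizedD (diagonalized_scalar (ln c) FT.1) FT.
have fE j : f 0 j = ln (e 0 j / c).
  rewrite mxE; have -> : e 0 j / c = 1 - b 0 j.
    by rewrite !mxE mulNr opprD opprK addrA subrr add0r mulrC.
  exact: cvg_lim (lb j).
have -> : const_mx (ln c) + f = map_mx (@ln R) e.
  apply/rowP => j; rewrite mxE fE !mxE ln_div ?posrE//.
  by rewrite addrC subrK.
move=> /(diagonalized_conj Qu); rewrite mulmxKV// => YT.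
have <- : mexp (L ((ln c)%:M + mxpser logcoef (B x))) = S x.
  have := mexp_diagonalized YT; have -> : map_mx expR (map_mx (@ln R) e) = e.
    by apply/rowP => j; rewrite !mxE lnK// posrE.
  by move=> h; exact: diagonalized_inj h ST.
by rewrite mlogK//; exists T, (map_mx (@ln R) e).
Qed.

End SmoothFunctionalCalculus.

End Exponential.

(** * Compatible complex structures on a symplectic vector space *)

Section AssociatedMatrices.
Context {R : realType} {n : nat}.
Implicit Types W K X Y S : 'M[R]_n.

(** With vectors as rows, [W] is the matrix of the symplectic form and [X] that of
    a positive associated complex structure; its metric has matrix [W X^T]. *)
Definition associated_mx W X := [/\ X *m X = - 1%:M, X *m W *m X^T = W &
  forall u : 'rV[R]_n, u != 0 -> 0 < (u *m W *m X^T *m u^T) 0 0].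

Lemma associated_swap W X : associated_mx W X -> X *m W = - (W *m X^T).
Proof.
move=> [XX XW _].
by rewrite -{2}XW -!mulmxA -trmx_mul XX !mulmxA linearN /= trmx1 mulmxN mulmx1 opprK.
Qed.

Lemma associated_posdef W X : W^T = - W -> associated_mx W X -> posdef (W *m X^T).
Proof.
move=> Wa aX; split.
  by rewrite trmx_mul trmxK Wa mulmxN (associated_swap aX) opprK.
by case: aX => _ _ pX u /pX; rewrite !mulmxA.
Qed.

Section Fixed.
Variables (W K : 'M[R]_n).
Hypotheses (Wa : W^T = - W) (aK : associated_mx W K).
Let G := W *m K^T.

(** Since [Y] anticommutes with [K], [K e^Y = e^(-Y) K], so the square of
    [e^Y K] is that of [K].  As [Y] is also symmetric for the metric
    [W K^T], one has [Y W = - W Y^T], so [e^Y] preserves [W].  The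
    metric of [e^Y K] at [u] is the old one at [u e^(Y/2)]. *)
Lemma associated_mexp Y : selfadj G Y -> K *m Y = - (Y *m K) ->
  associated_mx W (mexp Y *m K).
Proof.
move=> sY aY; have [KK KW _] := aK; have Gp := associated_posdef Wa aK.
have rY := spectral Gp sY.
have KE : K *m mexp Y = mexp (- Y) *m K.
  by apply/esym/mexp_intertwine; rewrite mulNmx aY.
have YG : mexp Y *m G = G *m (mexp Y)^T.
  by rewrite trmx_mexp; apply: mexp_intertwine.
split.
- by rewrite mulmxA -(mulmxA _ K) KE mulmxA mexpN// mul1mx.
- rewrite trmx_mul !mulmxA.
  have -> : mexp Y *m K *m W *m K^T = mexp Y *m W by rewrite -!mulmxA (mulmxA K) KW.
  have YW : mexp Y *m W = W *m (mexp (- Y))^T.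
    have -> : W = - (G *m K^T).
      by rewrite /G -mulmxA -trmx_mul KK linearN /= trmx1 mulmxN mulmx1 opprK.
    rewrite mulmxN mulmxA YG mulNmx -!mulmxA -!trmx_mul; congr (- (_ *m _^T)).
    by rewrite KE.
  by rewrite YW -mulmxA -trmx_mul mexpN// trmx1 mulmx1.
- move=> u u0.
  have rH := mexp_half rY; set E := mexp (2^-1 *: Y) in rH.
  have EG : E *m G = G *m E^T.
    rewrite /E trmx_mexp; apply: mexp_intertwine.
    by rewrite -scalemxAl sY linearZ /= -scalemxAr.
  have -> : u *m W *m (mexp Y *m K)^T = u *m E *m G *m E^T.
    by rewrite trmx_mul !mulmxA -(mulmxA u) -/G -(mulmxA u) -YG -rH -(mulmxA E) EG !mulmxA.
  rewrite -(mulmxA _ (E^T)) -trmx_mul.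
  case: Gp => _ Gp; apply: Gp; apply: contra u0 => /eqP uE; apply/eqP.
  by rewrite -[u]mulmx1 -(mexpN rY) -rH !mulmxA uE !mul0mx.
Qed.

(** [S] relates the metrics of [X] and [K]: [S (W K^T) = W X^T].  So it is
    self-adjoint, and pairing this with eigenvectors makes its eigenvalues
    positive. *)
Lemma associated_quotient X S : associated_mx W X -> S = - (X *m K) ->
  [/\ S *m K = X, selfadj G S & pdiag S].
Proof.
move=> aX ->; have [KK KW _] := aK; have [XX XW pX] := aX.
have Gp := associated_posdef Wa aK.
have SK : - (X *m K) *m K = X.
  by rewrite mulNmx -mulmxA KK mulmxN mulmx1 opprK.
have SG : - (X *m K) *m G = W *m X^T.
  rewrite /G mulNmx -[LHS]mulNmx.
  rewrite -(opprK (W *m X^T)) -(associated_swap aX) mulNmx; congr (- _).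
  by rewrite -!mulmxA (mulmxA K) KW.
have sS : selfadj G (- (X *m K)).
  rewrite /selfadj SG linearN /= trmx_mul mulmxN /G !mulmxA -(mulmxA W) -trmx_mul KK.
  by rewrite linearN /= trmx1 mulmxN mulmx1 mulNmx opprK.
split=> //; have [Q [d SQ]] := spectral Gp sS.
exists Q, d; split=> // j.
have [q0 qS] := diagonalized_row j SQ; set q := row j Q in q0 qS.
have := pX q q0; rewrite -(mulmxA q W) -SG !mulmxA qS.
rewrite -!scalemxAl mxE pmulr_lgt0//.
by case: Gp => _ /(_ q q0); rewrite /G !mulmxA.
Qed.

(** The adjoint of [Y] for the metric and [- K Y K^-1] are diagonalizable logarithms of the
    adjoint of [e^Y] and of [K e^(-Y) K^-1], which are both [e^Y].  By uniqueness of
    the logarithm they equal [Y]. *)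
Lemma associated_log X Y : associated_mx W X -> rdiag Y -> mexp Y *m K = X ->
  selfadj G Y /\ K *m Y = - (Y *m K).
Proof.
move=> aX rY EX; have [KK KW _] := aK; have [XX _ _] := aX.
have Gp := associated_posdef Wa aK; have Gu := posdef_unit Gp.
have Ku : K \in unitmx.
  by have := mulmx1_unit (_ : K *m (- K) = 1%:M) => -[]//; rewrite mulmxN KK opprK.
have ES : mexp Y = - (X *m K).
  by rewrite -EX -mulmxA KK mulmxN mulmx1 opprK.
have [_ sS _] := associated_quotient aX (erefl _).
have [Q [d YQ]] := rY; have [Qu YE] := YQ.
have rdT (Z T : 'M[R]_n) : T \in unitmx -> rdiag Z -> rdiag (invmx T *m Z *m T).
  by move=> Tu [Q' [d' h]]; exists (Q' *m T), d'; exact: diagonalized_conj h.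
split.
- have rYt : rdiag Y^T.
    exists (invmx Q)^T, d; split; first by rewrite unitmx_tr unitmx_inv.
    by rewrite YE !trmx_mul tr_diag_mx -trmx_inv invmxK mulmxA.
  have Gi : invmx G \in unitmx by rewrite unitmx_inv.
  have := rdT _ _ Gi rYt; rewrite invmxK => rZ.
  have E : mexp (G *m Y^T *m invmx G) = mexp Y.
    have h : mexp (G *m Y^T *m invmx G) *m G = G *m mexp Y^T.
      by apply: mexp_intertwine; rewrite mulmxKV.
    rewrite -[LHS](mulmxK Gu) h -trmx_mexp ES -sS mulmxK//.
  have := mexp_inj rZ rY E => /(congr1 (mulmx^~ G)); rewrite /= mulmxKV// => ->.
- have Ki : invmx K \in unitmx by rewrite unitmx_inv.
  have := rdT _ _ Ki rY; rewrite invmxK => rZ.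
  have rN : rdiag (- Y).
    by exists Q, ((-1) *: d); rewrite -scaleN1r; exact: diagonalizedZ.
  have E : mexp (K *m Y *m invmx K) = mexp (- Y).
    have h : mexp (K *m Y *m invmx K) *m K = K *m mexp Y.
      by apply: mexp_intertwine; rewrite mulmxKV.
    rewrite -[LHS](mulmxK Ku) h.
    rewrite -[RHS]mul1mx.
    have -> : 1%:M = K *m mexp Y *m invmx K *m mexp Y.
      have -> : invmx K = - K.
        by rewrite -[LHS]mul1mx -[1%:M]opprK -KK mulNmx mulmxK.
      rewrite ES !(mulmxN, mulNmx) !opprK -!mulmxA (mulmxA K K) KK.
      rewrite !(mulmxN, mulNmx) mul1mx (mulmxA X X) XX !(mulmxN, mulNmx) mul1mx.
      by rewrite KK !opprK.
    by rewrite -!mulmxA mexpN// !mulmxA mulmx1.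
  have := mexp_inj rZ rN E => /(congr1 (mulmx^~ K)); rewrite /= mulmxKV// => ->.
  by rewrite mulNmx.
Qed.

End Fixed.
End AssociatedMatrices.

(** * Endomorphisms of tangent spaces in coordinates *)

Section TangentCoordinates.
Context {R : realType} {n : nat} {M : manifold R n}.

Lemma tangent_coord_linear (p : M) (i : atlas M) : linear (fun v : tangent p => v i).
Proof. by move=> c u v. Qed.

Lemma tangent_coord_inj (p : M) (i : atlas M) (u v : tangent p) :
  dom i p -> u i = v i -> u = v.
Proof. by move=> pi; have [_ inj _] := tangent_coord_bij pi; apply: inj; rewrite inE. Qed.

Lemma tangent_coord_surj (p : M) (i : atlas M) (e : 'rV[R]_n) :
  dom i p -> exists v : tangent p, v i = e.
Proof.
move=> pi; have [_ _ surj] := tangent_coord_bij pi.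
by have [v _ <-] := surj e I; exists v.
Qed.

(** The convention of [smooth_endo]: matrices act on rows, so composition of maps
    reverses the order of the factors. *)
Definition matrix_in (p : M) (i : atlas M) (L : tangent p -> tangent p) (A : 'M[R]_n) :=
  forall v, L v i = v i *m A.

Lemma matrix_in_inj (p : M) (i : atlas M) (L L' : tangent p -> tangent p) A :
  dom i p -> matrix_in i L A -> matrix_in i L' A -> L =1 L'.
Proof. by move=> pi LA LA' v; apply: (tangent_coord_inj pi); rewrite LA LA'. Qed.

Lemma matrix_in_unique (p : M) (i : atlas M) (L : tangent p -> tangent p) A B :
  dom i p -> matrix_in i L A -> matrix_in i L B -> A = B.
Proof.
move=> pi LA LB; apply/row_matrixP => k; rewrite !rowE.
by have [v <-] := tangent_coord_surj (delta_mx 0 k) pi; rewrite -LA LB.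
Qed.

Lemma matrix_in_linear (p : M) (i : atlas M) (L : tangent p -> tangent p) A :
  dom i p -> matrix_in i L A -> linear L.
Proof.
move=> pi LA c u v; apply: (tangent_coord_inj pi).
rewrite LA [(c *: u + v : tangent p) i]tangent_coord_linear mulmxDl -scalemxAl.
by rewrite -!LA [RHS]tangent_coord_linear.
Qed.

Lemma linear_matrix_in (p : M) (i : atlas M) (L : tangent p -> tangent p) :
  dom i p -> linear L -> exists A, matrix_in i L A.
Proof.
move=> pi lL.
have [s sK] := choice (fun e : 'rV[R]_n => tangent_coord_surj e pi).
have Ks (v : tangent p) : s (v i) = v by apply: (tangent_coord_inj pi); rewrite sK.
have ls : linear (fun e => L (s e) i).
  move=> c e f.
  have -> : s (c *: e + f) = c *: s e + s f.
    by apply: (tangent_coord_inj pi); rewrite [RHS]tangent_coord_linear !sK.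
  by rewrite lL [LHS]tangent_coord_linear.
exists (lin1_mx (linear_of ls)) => v.
by rewrite mul_rV_lin1 /= Ks.
Qed.

Lemma matrix_in_surj (p : M) (i : atlas M) (A : 'M[R]_n) :
  dom i p -> exists L : tangent p -> tangent p, matrix_in i L A.
Proof.
move=> pi; have [L LA] := choice (fun v : tangent p => tangent_coord_surj (v i *m A) pi).
by exists L.
Qed.

Lemma matrix_in_comp (p : M) (i : atlas M) (L L' : tangent p -> tangent p) A B :
  matrix_in i L A -> matrix_in i L' B -> matrix_in i (L' \o L) (A *m B).
Proof. by move=> LA LB v; rewrite /= LB LA mulmxA. Qed.

Lemma tangent_coord_series (p : M) (i : atlas M) (u : nat -> tangent p) k :
  series u k i = series (fun l => u l i) k.
Proof.
pose f := linear_of (@tangent_coord_linear p i).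
by rewrite /series /= -[LHS]/(f _) linear_sum.
Qed.

(** [tangent_exp] is a limit in all charts simultaneously.  The limit found in
    the chart [i] is carried to the other charts by the continuity of the
    differentials of the transition maps. *)
Lemma matrix_in_exp (p : M) (i : atlas M) (L : tangent p -> tangent p) A :
  dom i p -> matrix_in i L A -> matrix_in i (tangent_exp L) (mexp A).
Proof.
move=> pi LA v.
pose u k := (k`!%:R)^-1 *: iter k L v.
have uE k : u k i = v i *m (expcoef k *: A ^+ k).
  rewrite -scalemxAr /u -[LHS]/((k`!%:R)^-1 *: (iter k L v i)); congr (_ *: _).
  elim: k => [|k ih]; first by rewrite expr0 mulmx1.
  by rewrite iterS LA ih -mulmxA exprSr.
have lv : linear (fun X : 'M[R]_n => v i *m X).
  by move=> c X Y; rewrite mulmxDr -scalemxAr.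
have ui : series u k i @[k --> \oo] --> v i *m mexp A.
  have := linear_series lv (mexp_cvg (A := A)).
  apply: cvg_trans; apply: near_eq_cvg; apply: nearW => k.
  by rewrite tangent_coord_series; apply: eq_bigr => l _; rewrite uE.
have [w wi] := tangent_coord_surj (v i *m mexp A) pi.
have uw : tangent_cvg (series u) w.
  move=> j pj; have /asboolP[+ _] := coordP w => /(_ i j pi pj) ->.
  set D := 'd _ _; have Dc : {for w i, continuous D}.
    by apply: (@mx_linear_continuous R 1 n 'rV[R]_n D); exact: linearP.
  rewrite -wi in ui; have := cvg_comp (fun k => series u k i) D ui Dc.
  apply: cvg_trans; apply: near_eq_cvg; apply: nearW => k /=.
  by have /asboolP[+ _] := coordP (series u k) => /(_ i j pi pj).
have : tangent_cvg (series u) (tangent_exp L v).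
  by apply: (@xgetPex _ 0 [set w | tangent_cvg (series u) w]); exists w.
by move=> /(_ i pi) ul; exact: cvg_unique ul ui.
Qed.

End TangentCoordinates.

Section Pointwise.
Context {R : realType} {n : nat} {M : manifold R n}.
Variables (om : bilin_field M) (i : atlas M) (W : 'rV[R]_n -> 'M[R]_n) (p : M).
Hypotheses (gW : gram_in_chart om i W) (pi : dom i p).
Let Wp := W (chart i p).

Lemma mx_form_inj (A B : 'M[R]_n) :
  (forall u v : 'rV[R]_n, (u *m A *m v^T) 0 0 = (u *m B *m v^T) 0 0) -> A = B.
Proof.
move=> AB; apply/matrixP => k l; have := AB (delta_mx 0 k) (delta_mx 0 l).
by rewrite -!rowE trmx_delta -!colE !mxE.
Qed.

Lemma form_matrix_eq (L1 L2 L3 L4 : tangent p -> tangent p) A1 A2 A3 A4 :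
  matrix_in i L1 A1 -> matrix_in i L2 A2 -> matrix_in i L3 A3 -> matrix_in i L4 A4 ->
  (forall u v, om (L1 u) (L2 v) = om (L3 u) (L4 v)) <->
  A1 *m Wp *m A2^T = A3 *m Wp *m A4^T.
Proof.
move=> h1 h2 h3 h4; split=> [E|E u v].
  apply: mx_form_inj => e f.
  have [u <-] := tangent_coord_surj e pi; have [v <-] := tangent_coord_surj f pi.
  have := E u v; rewrite !(gW _ _ pi) h1 h2 h3 h4 !trmx_mul !mulmxA.
  by [].
rewrite !(gW _ _ pi) h1 h2 h3 h4 !trmx_mul !mulmxA.
by rewrite -(mulmxA (u i)) -(mulmxA (u i)) E !mulmxA.
Qed.

Lemma matrix_in_id : matrix_in i (@id (tangent p)) 1%:M.
Proof. by move=> v; rewrite mulmx1. Qed.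

Lemma matrix_in_opp (L : tangent p -> tangent p) A :
  matrix_in i L A -> matrix_in i (fun v => - L v) (- A).
Proof. by move=> LA v; rewrite mulmxN -LA. Qed.

Lemma matrix_in_eq (L L' : tangent p -> tangent p) A B :
  matrix_in i L A -> matrix_in i L' B -> (L =1 L') <-> A = B.
Proof.
move=> LA LB; split=> [LL|AB]; last by apply: (matrix_in_inj pi LA); rewrite AB.
by apply: (matrix_in_unique pi LA) => v; rewrite LL.
Qed.

(** All conditions on tensors at [p] become conditions on matrices in one chart. *)
Lemma associatedE (L : tangent p -> tangent p) X : matrix_in i L X ->
  [/\ forall v, L (L v) = - v, forall u v, om (L u) (L v) = om u v &
     forall u, u != 0 -> 0 < om u (L u)] <-> associated_mx Wp X.
Proof.
move=> LX.
have h1 := matrix_in_eq (matrix_in_comp LX LX) (matrix_in_opp matrix_in_id).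
have h2 := form_matrix_eq LX LX matrix_in_id matrix_in_id.
rewrite mul1mx trmx1 mulmx1 in h2.
have h3 : (forall u : tangent p, u != 0 -> 0 < om u (L u)) <->
    (forall u : 'rV[R]_n, u != 0 -> 0 < (u *m Wp *m X^T *m u^T) 0 0).
  split=> [h e e0|h u u0].
    have [u ue] := tangent_coord_surj e pi.
    have := h u; rewrite (gW _ _ pi) LX trmx_mul !mulmxA ue; apply.
    by apply: contra e0 => /eqP u0; rewrite -ue u0.
  rewrite (gW _ _ pi) LX trmx_mul !mulmxA; apply: h.
  by apply: contra u0 => /eqP u0; apply/eqP/(tangent_coord_inj pi).
by split=> -[/h1 ? /h2 ? /h3 ?].
Qed.

Lemma gram_antisym : (forall u : tangent p, om u u = 0) -> Wp^T = - Wp.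
Proof.
move=> om0; have z (e : 'rV[R]_n) : (e *m Wp *m e^T) 0 0 = 0.
  by have [u <-] := tangent_coord_surj e pi; rewrite -(gW _ _ pi) om0.
apply/matrixP => k l; have := z (delta_mx 0 k + delta_mx 0 l).
rewrite linearD /= !mulmxDl !mulmxDr [LHS]mxE [X in X + _]mxE [X in _ + X]mxE !z.
rewrite add0r addr0 -!rowE !trmx_delta -!colE !mxE => /eqP.
by rewrite addrC addr_eq0 => /eqP ->.
Qed.

Section WithJ0.
Variables (J0 : tangent p -> tangent p) (K : 'M[R]_n).
Hypothesis J0K : matrix_in i J0 K.

Lemma selfadjE (L : tangent p -> tangent p) Y : matrix_in i L Y ->
  (forall u v, om (L u) (J0 v) = om u (J0 (L v))) <-> selfadj (Wp *m K^T) Y.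
Proof.
move=> LY.
have := form_matrix_eq LY J0K matrix_in_id (matrix_in_comp LY J0K).
by rewrite mul1mx trmx_mul /selfadj !mulmxA.
Qed.

Lemma anticommE (L : tangent p -> tangent p) Y : matrix_in i L Y ->
  (forall v, L (J0 v) = - J0 (L v)) <-> K *m Y = - (Y *m K).
Proof.
move=> LY.
exact: (matrix_in_eq (matrix_in_comp J0K LY) (matrix_in_opp (matrix_in_comp LY J0K))).
Qed.

End WithJ0.
End Pointwise.

(** * The correspondence *)

Theorem proposition3p4 (R : realType) (n : nat) (M : manifold R n)
    (M_compact : compact [set: M])
    (om : bilin_field M) (om_symplectic : symplectic om)
    (J0 : endo_field M) (J0_pos : positive_associated om J0) :
  set_bij (End_SJ om J0) (A_om om)
    (fun (P : endo_field M) p v => J0 p (tangent_exp (P p) v)).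
Proof.
have [[_ _ om0 gramW] _ _] := om_symplectic.
have [[[J0l J0s] J0J0] J0om J0p] := J0_pos.
have J0a i (W : 'rV[R]_n -> 'M[R]_n) p K : gram_in_chart om i W -> dom i p ->
    matrix_in i (J0 p) K -> associated_mx (W (chart i p)) K.
  move=> gW pi JK.
  exact: (associatedE gW pi JK).1 (And3 (J0J0 p) (J0om p) (J0p p)).
have openD i : open (chart i @` dom i : set 'rV[R]_n) := @codom_open R n M i.
split.
- move=> P [[Pl Ps] Psym Pac]; rewrite /A_om /=.
  have key p : exists i K Y W, [/\ dom i p, gram_in_chart om i W,
      matrix_in i (J0 p) K, matrix_in i (P p) Y &
      [/\ associated_mx (W (chart i p)) K, selfadj (W (chart i p) *m K^T) Y,
      K *m Y = - (Y *m K) & (W (chart i p))^T = - W (chart i p)]].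
    have [i pi] := dom_cover p; have [W gW sW] := gramW i.
    have [K JK] := linear_matrix_in pi (J0l p); have [Y PY] := linear_matrix_in pi (Pl p).
    exists i, K, Y, W; split=> //; split.
    + exact: J0a JK.
    + by apply/(selfadjE gW pi JK PY) => u v; exact: Psym.
    + by apply/(anticommE pi JK PY) => v; exact: Pac.
    + exact: gram_antisym gW pi (om0 p).
  have aJ p : let J v := J0 p (tangent_exp (P p) v) in
      [/\ forall v, J (J v) = - v, forall u v, om p (J u) (J v) = om p u v &
       forall u, u != 0 -> 0 < om p u (J u)].
    have [i [K [Y [W [pi gW JK PY [aK sY aY Wa]]]]]] := key p.
    apply/(associatedE gW pi (matrix_in_comp (matrix_in_exp pi PY) JK)).
    exact: associated_mexp.
  split; [split; [split|]|..].
  + move=> p; have [i [K [Y [W [pi gW JK PY _]]]]] := key p.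
    exact: matrix_in_linear pi (matrix_in_comp (matrix_in_exp pi PY) JK).
  + move=> i; have [K [sK JK]] := J0s i; have [Y [sY PY]] := Ps i.
    exists (fun x => mexp (Y x) *m K x); split.
      by move=> k; apply: C_k_mulmx => //; apply: C_k_mexp.
    move=> p v pi.
    have PYp : matrix_in i (P p) (Y (chart i p)) by move=> w; exact: PY.
    have JKp : matrix_in i (J0 p) (K (chart i p)) by move=> w; exact: JK.
    exact: (matrix_in_comp (matrix_in_exp pi PYp) JKp).
  + by move=> p v; have [h _ _] := aJ p; exact: h.
  + by move=> p u v; have [_ h _] := aJ p; exact: h.
  + by move=> p u u0; have [_ _ h] := aJ p; exact: h.
- move=> P P' /set_mem[[Pl Ps] Psym Pac] /set_mem[[P'l P's] P'sym P'ac] PP'.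
  apply: functional_extensionality_dep => p; apply/funext => v.
  have [i pi] := dom_cover p; have [W gW sW] := gramW i.
  have [K JK] := linear_matrix_in pi (J0l p).
  have [Y PY] := linear_matrix_in pi (Pl p); have [Y' PY'] := linear_matrix_in pi (P'l p).
  have aK := J0a _ _ _ _ gW pi JK.
  have Gp := associated_posdef (gram_antisym gW pi (om0 p)) aK.
  have rY : rdiag Y by apply: (spectral Gp); apply/(selfadjE gW pi JK PY) => ? ?; exact: Psym.
  have rY' : rdiag Y' by apply: (spectral Gp); apply/(selfadjE gW pi JK PY') => ? ?; exact: P'sym.
  have E : mexp Y *m K = mexp Y' *m K.
    apply: (matrix_in_unique pi (matrix_in_comp (matrix_in_exp pi PY) JK)).
    move=> w; have h : J0 p (tangent_exp (P p) w) = J0 p (tangent_exp (P' p) w) :=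
      congr1 (fun f : endo_field M => f p w) PP'.
    rewrite /= h; exact: (matrix_in_comp (matrix_in_exp pi PY') JK).
  have EY : Y = Y'.
    apply: mexp_inj => //; have [KK _ _] := aK.
    move/(congr1 (mulmx^~ K)): E; rewrite /= -!mulmxA KK !mulmxN !mulmx1.
    exact: oppr_inj.
  by apply: (matrix_in_inj pi PY); rewrite EY.
- move=> J [[[Jl Js] JJ] Jom Jp].
  have key p : exists L : tangent p -> tangent p, linear L /\
     [/\ forall u v, om p (L u) (J0 p v) = om p u (J0 p (L v)),
     forall v, L (J0 p v) = - J0 p (L v) &
     forall v, J0 p (tangent_exp L v) = J p v].
    have [i pi] := dom_cover p; have [W gW sW] := gramW i.
    have [K JK] := linear_matrix_in pi (J0l p); have [X JX] := linear_matrix_in pi (Jl p).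
    have aK := J0a _ _ _ _ gW pi JK; have Wa := gram_antisym gW pi (om0 p).
    have aX := (associatedE gW pi JX).1 (And3 (JJ p) (Jom p) (Jp p)).
    have [SK _ pS] := associated_quotient Wa aK aX (erefl _).
    have [Y rY SY] := mexp_surj pS; rewrite -SY in SK.
    have [sY aY] := associated_log Wa aK aX rY SK.
    have [L LY] := matrix_in_surj Y pi.
    exists L; split; first exact: matrix_in_linear pi LY.
    split.
    + exact/(selfadjE gW pi JK LY).
    + exact/(anticommE pi JK LY).
    + by apply: (matrix_in_inj pi (matrix_in_comp (matrix_in_exp pi LY) JK)); rewrite SK.
  pose P p := projT1 (cid (key p)).
  have PE p := projT2 (cid (key p)); rewrite -/(P _) in PE.
  have Jexp p v : J0 p (tangent_exp (P p) v) = J p v.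
    by have [_ [_ _ h]] := PE p; exact: h.
  exists P; last by apply: functional_extensionality_dep => p; apply/funext => v; exact: Jexp.
  split; last 2 first.
  + by move=> p; have [_ [h _ _]] := PE p.
  + by move=> p; have [_ [_ h _]] := PE p.
  split=> [p|i]; first by have [h _] := PE p.
  have [X [sX JX]] := Js i; have [K [sK JK]] := J0s i; have [W gW sW] := gramW i.
  (* the matrix of [J0^-1 J], as [J0^-1 = - J0] *)
  pose S x := - (X x *m K x).
  have coords p : dom i p -> matrix_in i (P p) (mlog (S (chart i p))) /\ pdiag (S (chart i p)).
    move=> pi; have [Pl [Psym Pac _]] := PE p.
    have JKp : matrix_in i (J0 p) (K (chart i p)) by move=> w; exact: JK.
    have JXp : matrix_in i (J p) (X (chart i p)) by move=> w; exact: JX.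
    have aK := J0a _ _ _ _ gW pi JKp; have Wa := gram_antisym gW pi (om0 p).
    have aX := (associatedE gW pi JXp).1 (And3 (JJ p) (Jom p) (Jp p)).
    have [SK _ pS] := associated_quotient Wa aK aX (erefl _).
    have [Y PY] := linear_matrix_in pi Pl.
    have rY : rdiag Y.
      by apply: (spectral (associated_posdef Wa aK)); apply/(selfadjE gW pi JKp PY).
    have EX : mexp Y *m K (chart i p) = X (chart i p).
      apply: (matrix_in_unique pi (matrix_in_comp (matrix_in_exp pi PY) JKp)) => w.
      by rewrite /= Jexp JXp.
    have ES : mexp Y = S (chart i p).
      by rewrite /S -EX -mulmxA; case: aK => -> _ _; rewrite mulmxN mulmx1 opprK.
    by split=> //; rewrite -ES mlogK.
  exists (fun x => mlog (S x)); split=> [k|p v pi]; last by have [h _] := coords p pi.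
  apply: C_k_mlog => //; last by move=> _ [p pi <-]; have [] := coords p pi.
  apply: (C_k_linear_mx (L := -%R)) => //.
    by move=> c A B; rewrite opprD scalerN.
  exact: C_k_mulmx.
Qed.
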